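(* Let $R$ be a commutative Noetherian local ring with $\operatorname{depth}(R)=t$, let $C$ be a semidualizing $R$-module, and let $M$ and $N$ be finitely generated $R$-modules. Assume $M=\Omega_R L$ for some finitely generated nonfree $R$-module $L$ with $\operatorname{depth}_R(L)\geq t$. If $t\geq 1$, assume further that $\operatorname{Ext}_R^i(M,C)=0$ for all $i=1,\dots,t$. Then the following conditions are equivalent: (i) $N=0$. (ii) $\operatorname{pd}_R(M\otimes_R N)<\infty$. (iii) $\operatorname{pd}_R\big(\operatorname{Hom}_R(C,M\otimes_R N)\big)<\infty$.
   Context: $\operatorname{pd}_R$ denotes projective dimension, with $\operatorname{pd}_R(0)=-\infty$. A finitely generated $R$-module $C$ is semidualizing if $\operatorname{Ext}_R^i(C,C)=0$ for all $i\geq 1$ and the homothety map $R\to\operatorname{Hom}_R(C,C)$ is an isomorphism. For a module $L$ over a local ring $R$, $\Omega_R L$ denotes the first syzygy of $L$ in its minimal free resolution, i.e. the kernel of a surjection $R^{\oplus \mu_R(L)}\to L$, where $\mu_R(L)$ is the minimal number of generators of $L$. *)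

(* Defs.v *)
From HB Require Import structures.
From mathcomp Require Import all_boot all_order all_algebra.
From mathcomp Require Import generic_quotient ring_quotient.
From mathcomp Require Import boolp classical_sets functions.
From mathcomp Require Import freeg.

Set Implicit Arguments.
Unset Strict Implicit.
Unset Printing Implicit Defensive.

Import GRing.Theory.
Import Quotient.Exports.

Local Open Scope ring_scope.
Local Open Scope classical_set_scope.

Section Submodules.
Variables (R : comNzRingType) (M : lmodType R).

Definition is_submodule (S : set M) : Prop :=
  S 0 /\ forall (a : R) (x y : M), S x -> S y -> S (a *: x + y).

Definition span (A : set M) : set M := smallest is_submodule A.

Lemma span_is_submodule (A : set M) : is_submodule (span A).
Proof.
split=> [S [[]] //|a x y Ax Ay S SA].
by case: (SA) => -[_ linS] _; apply: linS; [exact: Ax|exact: Ay].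
Qed.

Definition finitely_generated : Prop := exists s : seq M, span [set` s] = setT.

Definition is_zero_module : Prop := forall x : M, x = 0.

(* [min_number_gens n] is mu_R(M) = n *)
Definition min_number_gens (n : nat) : Prop :=
  (exists2 s : seq M, size s = n & span [set` s] = setT) /\
  forall s : seq M, span [set` s] = setT -> (n <= size s)%N.

Definition is_free_module : Prop :=
  exists (K : choiceType) (f : {linear {freeg K / R} -> M}), bijective f.

Definition span_mem (A : set M) : {pred M} := fun x => `[< span A x >].

Lemma span_mem_submod_closed (A : set M) : submod_closed (span_mem A).
Proof.
have [A0 linA] := span_is_submodule A.
split=> [|a x y /asboolP Ax /asboolP Ay]; apply/asboolP => //.
exact: linA.
Qed.

HB.instance Definition _ (A : set M) :=
  GRing.isSubmodClosed.Build R M (span_mem A) (span_mem_submod_closed A).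

(* M / span A *)
Definition quotmod (A : set M) : Type := Quotient.quot (span_mem A).

Section QuotientModule.
Local Open Scope quotient_scope.
Variable A : set M.

HB.instance Definition _ := GRing.Zmodule.on (quotmod A).

Definition quotmod_pi (x : M) : quotmod A := \pi_(Quotient.quot (span_mem A)) x.

Definition quotmod_scale (a : R) (x : quotmod A) : quotmod A :=
  quotmod_pi (a *: repr (x : Quotient.quot (span_mem A))).

Lemma quotmod_piP (x : quotmod A) : exists y, x = quotmod_pi y.
Proof. by exists (repr (x : Quotient.quot (span_mem A))); rewrite /quotmod_pi reprK. Qed.

Lemma quotmod_eqP (x y : M) : quotmod_pi x = quotmod_pi y <-> span A (x - y).
Proof.
rewrite /quotmod_pi; split=> [/eqP|]; last first.
  by move=> /asboolP Axy; apply/eqP; rewrite -Quotient.idealrBE.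
by rewrite -Quotient.idealrBE => /asboolP.
Qed.

Lemma quotmod_piD (x y : M) : quotmod_pi (x + y) = quotmod_pi x + quotmod_pi y.
Proof. by rewrite /quotmod_pi Quotient.pi_add. Qed.

Lemma quotmod_piZ (a : R) (x : M) :
  quotmod_pi (a *: x) = quotmod_scale a (quotmod_pi x).
Proof.
apply/quotmod_eqP; rewrite -scalerBr; have [A0 linA] := span_is_submodule A.
rewrite -[_ *: _]addr0; apply: (linA) => //; apply/quotmod_eqP.
by rewrite /quotmod_pi reprK.
Qed.

Fact quotmod_scaleA (a b : R) (x : quotmod A) :
  quotmod_scale a (quotmod_scale b x) = quotmod_scale (a * b) x.
Proof. by have [y ->] := quotmod_piP x; rewrite -!quotmod_piZ scalerA. Qed.

Fact quotmod_scale1 : left_id 1 quotmod_scale.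
Proof. by move=> x; have [y ->] := quotmod_piP x; rewrite -quotmod_piZ scale1r. Qed.

Fact quotmod_scaleDr : right_distributive quotmod_scale +%R.
Proof.
move=> a x y; have [x' ->] := quotmod_piP x; have [y' ->] := quotmod_piP y.
by rewrite -quotmod_piD -!quotmod_piZ scalerDr quotmod_piD.
Qed.

Fact quotmod_scaleDl (x : quotmod A) :
  {morph quotmod_scale^~ x : a b / a + b}.
Proof.
move=> a b; have [x' ->] := quotmod_piP x.
by rewrite -!quotmod_piZ scalerDl quotmod_piD.
Qed.

HB.instance Definition _ := GRing.Zmodule_isLmodule.Build R (quotmod A)
  quotmod_scaleA quotmod_scale1 quotmod_scaleDr quotmod_scaleDl.

End QuotientModule.
End Submodules.

(* Hom_R(U, V), carried by the type of linear maps *)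
Section HomModule.
Variables (R : comNzRingType) (U V : lmodType R).
Implicit Types f g h : {linear U -> V}.

HB.instance Definition _ := gen_eqMixin {linear U -> V}.
HB.instance Definition _ := gen_choiceMixin {linear U -> V}.

Lemma linear_eq f g : f =1 g -> f = g.
Proof.
case: f g => [f [[f1] [f2]]] [g [[g1] [g2]]] /= /funext fg.
case: _ / fg in g1 g2 *.
by rewrite (Prop_irrelevance f1 g1) (Prop_irrelevance f2 g2).
Qed.

Definition hom_zero : {linear U -> V} := \0.
Definition hom_opp f : {linear U -> V} := \- f.
Definition hom_add f g : {linear U -> V} := f \+ g.

Fact hom_scale_linear (a : R) f : linear (fun x => a *: f x).
Proof. by move=> b x y; rewrite linearP scalerDr !scalerA mulrC. Qed.

Definition hom_scale (a : R) f : {linear U -> V} :=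
  HB.pack (fun x => a *: f x)
    (GRing.isLinear.Build R U V *:%R (fun x => a *: f x) (hom_scale_linear a f)).

Fact hom_addA : associative hom_add.
Proof. by move=> f g h; apply: linear_eq => x /=; rewrite addrA. Qed.
Fact hom_addC : commutative hom_add.
Proof. by move=> f g; apply: linear_eq => x /=; rewrite addrC. Qed.
Fact hom_add0 : left_id hom_zero hom_add.
Proof. by move=> f; apply: linear_eq => x /=; rewrite add0r. Qed.
Fact hom_addN : left_inverse hom_zero hom_opp hom_add.
Proof. by move=> f; apply: linear_eq => x /=; rewrite addNr. Qed.

HB.instance Definition _ := GRing.isZmodule.Build {linear U -> V}
  hom_addA hom_addC hom_add0 hom_addN.

Fact hom_scaleA (a b : R) f : hom_scale a (hom_scale b f) = hom_scale (a * b) f.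
Proof. by apply: linear_eq => x /=; rewrite scalerA. Qed.
Fact hom_scale1 : left_id 1 hom_scale.
Proof. by move=> f; apply: linear_eq => x /=; rewrite scale1r. Qed.
Fact hom_scaleDr : right_distributive hom_scale +%R.
Proof. by move=> a f g; apply: linear_eq => x /=; rewrite scalerDr. Qed.
Fact hom_scaleDl f : {morph hom_scale^~ f : a b / a + b}.
Proof. by move=> a b; apply: linear_eq => x /=; rewrite scalerDl. Qed.

HB.instance Definition _ := GRing.Zmodule_isLmodule.Build R {linear U -> V}
  hom_scaleA hom_scale1 hom_scaleDr hom_scaleDl.

End HomModule.

Section TensorProduct.
Variables (R : comNzRingType) (M N : lmodType R).

Definition tensor_gen (x : M) (y : N) : {freeg (M * N)%type / R} := << (x, y) >>.

Inductive tensor_rel : {freeg (M * N)%type / R} -> Prop :=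
| tensor_relDl (x x' : M) (y : N) :
    tensor_rel (tensor_gen (x + x') y - tensor_gen x y - tensor_gen x' y)
| tensor_relDr (x : M) (y y' : N) :
    tensor_rel (tensor_gen x (y + y') - tensor_gen x y - tensor_gen x y')
| tensor_relZl (a : R) (x : M) (y : N) :
    tensor_rel (tensor_gen (a *: x) y - a *: tensor_gen x y)
| tensor_relZr (a : R) (x : M) (y : N) :
    tensor_rel (tensor_gen x (a *: y) - a *: tensor_gen x y).

Definition tensor : Type := quotmod (tensor_rel : set {freeg (M * N)%type / R}).

HB.instance Definition _ := GRing.Lmodule.on tensor.

End TensorProduct.

Section Kernel.
Variables (R : comNzRingType) (U V : lmodType R) (f : {linear U -> V}).

Definition ker_mem : {pred U} := fun x => f x == 0.

Lemma ker_mem_submod_closed : submod_closed ker_mem.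
Proof.
split=> [|a x y]; rewrite !unfold_in; first by rewrite linear0.
by rewrite linearP => /eqP-> /eqP->; rewrite scaler0 addr0.
Qed.

HB.instance Definition _ :=
  GRing.isSubmodClosed.Build R U ker_mem ker_mem_submod_closed.

Definition kernel : Type := {x : U | x \in ker_mem}.

HB.instance Definition _ := SubChoice.on kernel.
HB.instance Definition _ := [SubChoice_isSubLmodule of kernel by <:].

End Kernel.

(* [is_first_syzygy L M] states M = Omega_R L, up to isomorphism *)
Definition is_first_syzygy (R : comNzRingType) (L M : lmodType R) : Prop :=
  exists (n : nat) (p : {linear 'rV[R]_n -> L}) (f : {linear M -> kernel p}),
    [/\ min_number_gens L n, range p = setT & bijective f].

Definition is_ideal (R : comNzRingType) (I : set R) : Prop :=
  is_submodule (I : set R^o).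

Definition noetherian (R : comNzRingType) : Prop :=
  forall I : set R, is_ideal I -> exists s : seq R^o, span [set` s] = I.

Definition maximal_ideal (R : comNzRingType) (m : set R) : Prop :=
  [/\ is_ideal m, m <> setT &
      forall I : set R, is_ideal I -> m `<=` I -> I = m \/ I = setT].

(* R is local with maximal ideal m *)
Definition is_local (R : comNzRingType) (m : set R) : Prop :=
  maximal_ideal m /\ forall m' : set R, maximal_ideal m' -> m' = m.

Section Depth.
Variables (R : comNzRingType) (m : set R) (M : lmodType R).

(* generators of the submodule (xs)M *)
Definition seq_smul (xs : seq R) : set M :=
  [set v | exists x w, x \in xs /\ v = x *: w].

Definition regular_seq (xs : seq R) : Prop :=
  (forall i, (i < size xs)%N ->
     forall v : quotmod (seq_smul (take i xs)), xs`_i *: v = 0 -> v = 0) /\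
  ~ is_zero_module (quotmod (seq_smul xs)).

(* depth M is the supremum of the lengths of the M-regular sequences in m,
   with depth 0 = +oo *)
Definition depth_ge (n : nat) : Prop :=
  is_zero_module M \/
  exists xs : seq R,
    [/\ (n <= size xs)%N, {in xs, forall x, m x} & regular_seq xs].

Definition depth_eq (n : nat) : Prop := depth_ge n /\ ~ depth_ge n.+1.

End Depth.

Definition is_projective (R : comNzRingType) (P : lmodType R) : Prop :=
  forall (A B : lmodType R) (g : {linear A -> B}) (h : {linear P -> B}),
    range g = setT -> exists f : {linear P -> A}, forall x, g (f x) = h x.

Record proj_resolution (R : comNzRingType) (M : lmodType R) := ProjResolution {
  res_obj : nat -> lmodType R;
  res_diff : forall i, {linear res_obj i.+1 -> res_obj i};
  res_aug : {linear res_obj 0 -> M};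
  res_proj : forall i, is_projective (res_obj i);
  res_aug_surj : range res_aug = setT;
  res_exact0 : range (res_diff 0) = [set x | res_aug x = 0];
  res_exactS : forall i, range (res_diff i.+1) = [set x | res_diff i x = 0]
}.

Section FreeResolution.
Variable R : comNzRingType.

Section FreeModule.
Variables (K : choiceType) (M : lmodType R) (u : K -> M).

Lemma fglift_linear : linear (fglift u).
Proof.
have addF : additive (fglift u) by exact: lift_is_additive.
pose F : {additive {freeg K / R} -> M} :=
  HB.pack (fglift u) (GRing.isAdditive.Build _ _ (fglift u) addF).
have sumF I (r : seq I) (G : I -> {freeg K / R}) :
    fglift u (\sum_(i <- r) G i) = \sum_(i <- r) fglift u (G i).
  exact: (raddf_sum F).
move=> a x y; rewrite -[fglift u]/(F : _ -> _) raddfD; congr (_ + _) => /=.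
rewrite -[in RHS](freeg_sumE x) sumF scaler_sumr.
rewrite -[a *: x]/(fgscale a x) /fgscale sumF.
by apply: eq_bigr => k _; rewrite !liftU scalerA.
Qed.

Definition free_map : {linear {freeg K / R} -> M} :=
  HB.pack (fglift u) (GRing.isLinear.Build R _ M *:%R (fglift u) fglift_linear).

Lemma free_mapE (k : K) : free_map << k >> = u k.
Proof. by rewrite /= liftU scale1r. Qed.

Lemma freeg_linear_ext (f g : {linear {freeg K / R} -> M}) :
  (forall k, f << k >> = g << k >>) -> f =1 g.
Proof.
move=> fg x; rewrite -(freeg_sumE x) !linear_sum; apply: eq_bigr => k _.
have -> : << coeff k x *g k >> = coeff k x *: (<< k >> : {freeg K / R}).
  by apply/eqP/freeg_eqP => k'; rewrite coeffZ !coeffU mul1r.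
by rewrite !linearZ /= fg.
Qed.

End FreeModule.

Lemma freeg_projective (K : choiceType) : is_projective {freeg K / R}.
Proof.
move=> A B g h surjg.
have ex k : exists a, g a = h << k >>.
  have : range g (h << k >>) by rewrite surjg.
  by case=> a _ <-; exists a.
pose u k := sval (cid (ex k)).
exists (free_map u).
apply: (freeg_linear_ext (f := g \o free_map u)) => k /=.
by rewrite liftU scale1r /u; case: cid.
Qed.

Let cover (M : lmodType R) : {linear {freeg M / R} -> M} := free_map id.

Let syz (M : lmodType R) : lmodType R := kernel (cover M).

Let val_ker (M : lmodType R) : {linear syz M -> {freeg M / R}} := val.

Let iter_syz (M : lmodType R) (i : nat) : lmodType R := iter i syz M.

Let diff (M : lmodType R) : {linear {freeg (syz M) / R} -> {freeg M / R}} :=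
  val_ker M \o cover (syz M).

Let cover_surj (M : lmodType R) : range (cover M) = setT.
Proof.
by apply/seteqP; split=> // x _; exists << x >> => //; exact: free_mapE.
Qed.

Let range_diff (M : lmodType R) : range (diff M) = [set x | cover M x = 0].
Proof.
apply/seteqP; split=> [_ [y _ <-]|x /eqP x0] /=.
  by apply/eqP; exact: (valP (cover (syz M) y)).
pose z : syz M := exist _ x x0.
by exists << z >> => //=; rewrite liftU scale1r.
Qed.

Lemma proj_resolution_exists (M : lmodType R) : inhabited (proj_resolution M).
Proof.
constructor.
apply: (@ProjResolution R M (fun i => {freeg (iter_syz M i) / R})
  (fun i => diff (iter_syz M i)) (cover M)).
- by move=> i; exact: freeg_projective.
- exact: cover_surj.
- exact: range_diff.
- move=> i; rewrite range_diff; apply/seteqP; split=> x /=.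
    by move=> xx; rewrite xx.
  by move=> dx0; apply: val_inj.
Qed.

End FreeResolution.

Section Ext.
Variables (R : comNzRingType) (M N : lmodType R) (P : proj_resolution M).

Definition cocycles (i : nat) : set {linear res_obj P i -> N} :=
  [set f | forall x, f (res_diff P i x) = 0].

Definition coboundaries (i : nat) : set {linear res_obj P i -> N} :=
  match i with
  | 0 => [set 0]
  | j.+1 => [set f | exists g : {linear res_obj P j -> N},
                       forall x, f x = g (res_diff P j x)]
  end.

End Ext.

Arguments cocycles {R M} N P i _.
Arguments coboundaries {R M} N P i _.

(* Ext^i_R(M, N) = 0: the cohomology H^i(Hom(P, N)) vanishes for every
   projective resolution P of M; P exists by [proj_resolution_exists], and the
   vanishing does not depend on P *)
Definition Ext_eq0 (R : comNzRingType) (i : nat) (M N : lmodType R) : Prop :=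
  forall P : proj_resolution M, cocycles N P i `<=` coboundaries N P i.

(* pd_R(M) < oo; the convention pd_R(0) = -oo makes this true for M = 0, as
   does the zero resolution here *)
Definition finite_pd (R : comNzRingType) (M : lmodType R) : Prop :=
  exists (P : proj_resolution M) (n : nat),
    forall i, (n < i)%N -> is_zero_module (res_obj P i).

Definition homothety (R : comNzRingType) (C : lmodType R) (a : R) :
  {linear C -> C} := a *: (idfun : {linear C -> C}).

Definition semidualizing (R : comNzRingType) (C : lmodType R) : Prop :=
  [/\ finitely_generated C,
      forall i, (1 <= i)%N -> Ext_eq0 i C C &
      bijective (@homothety R C)].

(* Main.v *)
Require Import Defs.
From HB Require Import structures.
From mathcomp Require Import all_boot all_order all_algebra.
From mathcomp Require Import boolp classical_sets functions freeg.

Set Implicit Arguments.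
Unset Strict Implicit.
Unset Printing Implicit Defensive.

Import GRing.Theory Defs.
Local Open Scope ring_scope.
Local Open Scope classical_set_scope.

(** Let X be the tensor product of M and N, and suppose that N <> 0. Since L is
not free, M <> 0, and X <> 0 by Nakayama [tensor_eq0]. The contradiction comes
from comparing M and C modulo a regular sequence.

Choose a sequence xs of length t = depth R in m that is regular on both R and L
[common_maximal_regs]. It is maximal on R, so some s outside (xs) satisfies
s m <= (xs). As M is a minimal syzygy, it lies in mR^n, and M meets (xs)R^n in
(xs)M only because xs is L-regular; hence s M <= (xs)M [syzygy_socle]. On the
other hand R/(xs) = Hom(C, C/(xs)C) because C is semidualizing, so that
s C is not contained in (xs)C [sdual_quot_faithful].

Each finiteness hypothesis yields a nonzero module Y generated by images of
maps from M, with an exact sequence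

  0 -> C^b_p -> ... -> C^b_0 -> Y -> 0

whose matrices have entries in m and whose length p is at most t. For (iii) one
takes Y = X and the matrices of a minimal free resolution F of Hom(C, X)
[augment_exact]; for (ii) one takes the matrices of a minimal free resolution F
of X, and Y is then the tensor product of C and X [cokernel_generated]. In both
cases F is finite [minres_finite] of length at most t by the Auslander-Buchsbaum
bound [minres_depth_bound]. The complex of powers of C is exact because
Hom(C, _) turns it into F: a faithful finitely generated module has nonzero maps
to all nonzero modules [Hom_quot_neq0], so that a bounded complex of modules
with Ext^i(C, _) = 0 for i > 0 has no homology if it has none after applying
Hom(C, _) [exact_of_hom].

Since Ext^i(M, C) = 0 for 0 < i <= t, every map M -> Y lifts to C^b_0
[lift_from_module]. The images of these lifts generate C^b_0 modulo the kernel
of C^b_0 -> Y, which lies in m C^b_0, so by Nakayama C is generated by images of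
maps from M. Hence s M <= (xs)M gives s C <= (xs)C, which is absurd
[generated_by_syzygy]. The implication from (ii) to (iii) goes through N = 0. *)

Local Notation reg R := (R^o : lmodType R).
Local Notation pow C b := {ffun 'I_b -> C}.
Local Notation vec R b := {ffun 'I_b -> reg R}.

(** * Submodules and finite generation *)

Section SubmoduleTheory.
Variables (R : comNzRingType) (W : lmodType R).
Implicit Types (S T : set W) (u v w : W) (us : seq W).

Lemma submod0 S : is_submodule S -> S 0.
Proof. by case. Qed.

Lemma submodD S u v : is_submodule S -> S u -> S v -> S (u + v).
Proof. by case=> _ lS Su Sv; have := lS 1 _ _ Su Sv; rewrite scale1r. Qed.

Lemma submodZ S a u (sS : is_submodule S) : S u -> S (a *: u).
Proof. by case: sS => S0 lS Su; have := lS a _ _ Su S0; rewrite addr0. Qed.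

Lemma submodN S u : is_submodule S -> S u -> S (- u).
Proof. by move=> sS Su; rewrite -scaleN1r; apply: submodZ. Qed.

Lemma submodB S u v : is_submodule S -> S u -> S v -> S (u - v).
Proof. by move=> sS Su Sv; apply: submodD => //; apply: submodN. Qed.

Lemma submod_sum S (sS : is_submodule S) (I : Type) (r : seq I) (P : pred I)
    (F : I -> W) :
  (forall i, P i -> S (F i)) -> S (\sum_(i <- r | P i) F i).
Proof.
move=> SF; elim/big_ind: _ => //; first exact: submod0.
by move=> u v; apply: submodD.
Qed.

Lemma submodDr S u v : is_submodule S -> S u -> S (u + v) <-> S v.
Proof.
move=> sS Su; split=> [Suv|Sv]; last exact: submodD.
by rewrite -(addKr u v) addrC; apply: submodB.
Qed.

Lemma submod_set0 : is_submodule ([set 0] : set W).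
Proof. by split=> // a x y -> ->; rewrite scaler0 addr0. Qed.

Lemma submodI S T : is_submodule S -> is_submodule T -> is_submodule (S `&` T).
Proof.
move=> [S0 lS] [T0 lT]; split=> // a x y [Sx Tx] [Sy Ty].
by split; [apply: lS | apply: lT].
Qed.

Lemma span_sub (A : set W) : A `<=` span A.
Proof. by move=> x Ax S [_ /(_ x Ax)]. Qed.

Lemma span_min (A : set W) S : is_submodule S -> A `<=` S -> span A `<=` S.
Proof. by move=> sS AS x /(_ S); apply; split. Qed.

Lemma span_ind (A : set W) (P : W -> Prop) :
  is_submodule (P : set W) -> (forall v, A v -> P v) -> forall v, span A v -> P v.
Proof. exact: span_min. Qed.

Lemma span_mono (A B : set W) : A `<=` B -> span A `<=` span B.
Proof.
move=> AB; apply: span_min; first exact: span_is_submodule.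
by apply: subset_trans AB _; apply: span_sub.
Qed.

Lemma span_seq_nil v : span [set` [::] : seq W] v -> v = 0.
Proof. by move=> /(span_min submod_set0); apply=> x; rewrite /= in_nil. Qed.

Lemma span_seq_cons u us v :
  span [set` u :: us] v <-> exists a w, span [set` us] w /\ v = a *: u + w.
Proof.
have sU := span_is_submodule [set` us].
split=> [|[a [w [Uw ->]]]]; last first.
  have sU' := span_is_submodule [set` u :: us].
  apply: (submodD sU'); first apply: (submodZ _ sU').
    by apply: span_sub; rewrite /= mem_head.
  by apply: span_mono Uw => x /=; rewrite inE => ->; rewrite orbT.
move: v; refine (span_ind _ _).
  split; first by exists 0, 0; split; [exact: submod0 | rewrite scale0r addr0].
  move=> c _ _ [a [w [Uw ->]]] [a' [w' [Uw' ->]]].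
  exists (c * a + a'), (c *: w + w'); split; first by case: sU => _; apply.
  by rewrite scalerDr scalerDl scalerA !addrA; congr (_ + _); rewrite addrAC.
move=> x /=; rewrite inE => /orP[/eqP ->|Ux].
  by exists 1, 0; split; [exact: submod0 | rewrite scale1r addr0].
by exists 0, x; split; [exact: span_sub | rewrite scale0r add0r].
Qed.

Lemma span_seqP us v :
  span [set` us] v <-> exists a : nat -> R, v = \sum_(i < size us) a i *: us`_i.
Proof.
split=> [|[a ->]]; last first.
  have sU := span_is_submodule [set` us].
  apply: (submod_sum sU) => i _; apply: (submodZ _ sU).
  by apply: span_sub; rewrite /= mem_nth.
elim: us v => [v /span_seq_nil ->|u us IH v /span_seq_cons[a [w [/IH[b ->] ->]]]].
  by exists (fun=> 0); rewrite big_ord0.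
exists (fun i => if i is j.+1 then b j else a).
by rewrite big_ord_recl.
Qed.

Lemma span_seq_cat us vs v :
  span [set` us ++ vs] v <->
  exists u w, [/\ span [set` us] u, span [set` vs] w & v = u + w].
Proof.
elim: us v => [|u us IH] v /=.
  split=> [Vv|[u [w [/span_seq_nil -> Vw ->]]]]; last by rewrite add0r.
  by exists 0, v; split=> //; [apply: submod0; apply: span_is_submodule|rewrite add0r].
split=> [/span_seq_cons[a [_ [/IH[u' [w [Uu' Vw ->]]] ->]]]|].
  exists (a *: u + u'), w; split=> //; last by rewrite addrA.
  by apply/span_seq_cons; exists a, u'.
move=> [_ [w [/span_seq_cons[a [u' [Uu' ->]]] Vw ->]]].
by apply/span_seq_cons; exists a, (u' + w); split; [apply/IH; exists u', w | rewrite addrA].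
Qed.

Definition sumset S T : set W := [set w | exists u v, [/\ S u, T v & w = u + v]].

Lemma sumset_submod S T :
  is_submodule S -> is_submodule T -> is_submodule (sumset S T).
Proof.
move=> sS sT; split; first by exists 0, 0; split; [exact: submod0|exact: submod0|rewrite addr0].
move=> a _ _ [u [v [Su Tv ->]]] [u' [v' [Su' Tv' ->]]].
exists (a *: u + u'), (a *: v + v'); split; [by case: sS => _; apply|by case: sT => _; apply|].
by rewrite scalerDr addrACA.
Qed.

Lemma sumsetl S T : is_submodule T -> S `<=` sumset S T.
Proof. by move=> sT x Sx; exists x, 0; split=> //; [exact: submod0|rewrite addr0]. Qed.

Lemma sumsetr S T : is_submodule S -> T `<=` sumset S T.
Proof. by move=> sT x Sx; exists 0, x; split=> //; [exact: submod0|rewrite add0r]. Qed.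

(** S + xW. Quotients W/S are handled as congruences modulo a submodule S of a
fixed W; going from W/S to W/(S + xW) then only changes S, and no quotient of a
quotient is formed. *)
Definition add_mul S (x : R) : set W := [set w | exists u v, S u /\ w = u + x *: v].

Lemma add_mul_submod S x : is_submodule S -> is_submodule (add_mul S x).
Proof.
move=> sS; split; first by exists 0, 0; split; [exact: submod0|rewrite scaler0 addr0].
move=> a _ _ [u [v [Su ->]]] [u' [v' [Su' ->]]].
exists (a *: u + u'), (a *: v + v'); split; first by case: sS => _; apply.
by rewrite !scalerDr addrACA !scalerA (mulrC x).
Qed.

Lemma sub_add_mul S x : S `<=` add_mul S x.
Proof. by move=> u Su; exists u, 0; rewrite scaler0 addr0. Qed.

Lemma scale_add_mul S x v : is_submodule S -> add_mul S x (x *: v).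
Proof. by move=> sS; exists 0, v; split; [exact: submod0|rewrite add0r]. Qed.

Lemma add_mulC S x y : add_mul (add_mul S x) y = add_mul (add_mul S y) x.
Proof.
suff sub y' x' : add_mul (add_mul S y') x' `<=` add_mul (add_mul S x') y'.
  by apply/seteqP; split; apply: sub.
move=> _ [_ [w [[u [v [Su ->]]] ->]]].
by exists (u + x' *: w), v; split; [exists u, w|rewrite addrAC].
Qed.

Definition regmod S (x : R) := forall v, S (x *: v) -> S v.

Fixpoint regs S (xs : seq R) : Prop :=
  if xs is x :: xs' then regmod S x /\ regs (add_mul S x) xs' else True.

Definition add_muls S (xs : seq R) : set W := foldl add_mul S xs.

Lemma add_muls_submod S xs : is_submodule S -> is_submodule (add_muls S xs).
Proof. by elim: xs S => //= x xs IH S sS; apply/IH/add_mul_submod. Qed.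

Lemma regs_rcons S xs x : regs S (rcons xs x) <-> regs S xs /\ regmod (add_muls S xs) x.
Proof.
elim: xs S => [|y xs IH] S /=; first by split=> [[]|[]].
by split=> [[ry /IH[]]|[[ry rxs] rx]]; split=> //; apply/IH.
Qed.

Definition ideal_smul (m : set R) (U : set W) : set W :=
  span [set w | exists a v, [/\ m a, U v & w = a *: v]].

Lemma ideal_smul_submod m U : is_submodule (ideal_smul m U).
Proof. exact: span_is_submodule. Qed.

Lemma ideal_smul_scale (m : set R) U a v : m a -> U v -> ideal_smul m U (a *: v).
Proof. by move=> ma Uv; apply: span_sub; exists a, v. Qed.

End SubmoduleTheory.

Section LinearImages.
Variables (R : comNzRingType) (V W : lmodType R).
Implicit Types (f : {linear V -> W}).

Lemma preim_submod f (S : set W) : is_submodule S -> is_submodule (f @^-1` S).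
Proof.
move=> [S0 lS]; split; first by rewrite /= linear0.
by move=> a x y /=; rewrite linearP => ? ?; apply: lS.
Qed.

Lemma image_submod f (S : set V) : is_submodule S -> is_submodule (f @` S).
Proof.
move=> [S0 lS]; split; first by exists 0; rewrite ?linear0.
by move=> a _ _ [x Sx <-] [y Sy <-]; exists (a *: x + y); [apply: lS|rewrite linearP].
Qed.

Lemma span_image f (A : set V) v : span A v -> span (f @` A) (f v).
Proof.
move: v; apply: (@span_ind _ _ _ (fun v => span (f @` A) (f v))).
  exact/preim_submod/span_is_submodule.
by move=> x Ax; apply: span_sub; exists x.
Qed.

Lemma add_muls_linear f (S : set V) (T : set W) xs :
  (forall v, S v -> T (f v)) -> forall v, add_muls S xs v -> add_muls T xs (f v).
Proof.
elim: xs S T => //= x xs IH S T ST v; apply: IH => _ [u [w [Su ->]]].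
by exists (f u), (f w); split; [exact: ST|rewrite linearD linearZ].
Qed.

End LinearImages.

Section Noetherian.
Variables (R : comNzRingType).

Definition fg_set (W : lmodType R) (S : set W) := exists s : seq W, span [set` s] = S.

Hypothesis noeth : noetherian R.

(** With one generator u more, the elements of S are determined modulo those
in the span of the others by their u-coefficients, which form an ideal. *)
Lemma sub_span_fg (W : lmodType R) (us : seq W) (S : set W) :
  is_submodule S -> S `<=` span [set` us] -> fg_set S.
Proof.
elim: us S => [|u us IH] S sS SU.
  exists [::]; apply/seteqP; split; first by move=> x /span_seq_nil ->; apply: submod0.
  by move=> x /SU.
pose I : set R := [set a | exists2 w, span [set` us] w & S (a *: u + w)].
have sU := span_is_submodule [set` us].
have iI : is_ideal I.
  split; first by exists 0; rewrite ?scale0r ?addr0; apply: submod0.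
  move=> c a b [w Uw Sw] [w' Uw' Sw'].
  exists (c *: w + w'); first by case: sU => _; apply.
  case: sS => _ /(_ c _ _ Sw Sw'); congr S.
  by rewrite scalerDr scalerDl scalerA addrACA.
have [as_ asE] := noeth iI.
have [ss sspan] : fg_set (S `&` span [set` us]).
  by apply: IH => [|x []//]; apply: submodI.
have [ts [tS tI]] : exists ts : seq W, {in ts, forall t, S t} /\
    forall a, span [set` as_] a ->
      exists2 t, span [set` ts] t & exists2 w, span [set` us] w & t = a *: u + w.
  have : {in as_, forall a, I a} by move=> a aa; rewrite -asE; apply: span_sub.
  elim: (as_) => [_|a l IHl al].
    exists [::]; split=> // a /span_seq_nil ->; exists 0.
      exact: (submod0 (span_is_submodule _)).
    by exists 0; [exact: submod0|rewrite scale0r addr0].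
  have [|ts [tS tI]] := IHl; first by move=> b bl; apply: al; rewrite inE bl orbT.
  have [w Uw Sw] : I a by apply: al; rewrite mem_head.
  exists (a *: u + w :: ts); split.
    by move=> t; rewrite inE => /orP[/eqP ->//|]; apply: tS.
  move=> b /span_seq_cons[c [d [/tI[t Tt [w' Uw' tE]] ->]]].
  exists (c *: (a *: u + w) + t); first by apply/span_seq_cons; exists c, t.
  exists (c *: w + w'); first by case: sU => _; apply.
  by rewrite tE scalerDr scalerDl !scalerA addrACA.
exists (ts ++ ss); apply/seteqP; split.
  apply: span_min => // x /=; rewrite mem_cat => /orP[/tS//|xs].
  have : span [set` ss] x by apply: span_sub.
  by rewrite sspan => -[].
move=> x Sx; have /span_seq_cons[a [w [Uw xE]]] := SU _ Sx.
have Ia : span [set` as_] a by rewrite asE; exists w; rewrite -?xE.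
have [t Tt [w' Uw' tE]] := tI _ Ia.
apply/span_seq_cat; exists t, (x - t); split=> //; last by rewrite addrC subrK.
rewrite sspan; split.
  apply: submodB => //; move: t Tt {tE}; refine (span_ind _ _) => //.
have -> : x - t = w - w' by rewrite xE tE opprD addrACA subrr add0r.
exact: (submodB sU).
Qed.

Lemma submod_fg (W : lmodType R) (S : set W) :
  finitely_generated W -> is_submodule S -> fg_set S.
Proof. by move=> [us usE] sS; apply: (@sub_span_fg _ us) => //; rewrite usE. Qed.

Lemma span_finite_sub (W : lmodType R) (A : set W) :
  finitely_generated W -> exists2 s : seq W, {in s, forall v, A v} & span [set` s] = span A.
Proof.
move=> fgW; have [us usE] := submod_fg fgW (span_is_submodule A).
have one v : span A v -> exists2 s : seq W, {in s, forall v, A v} & span [set` s] v.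
  move: v; refine (span_ind _ _) => [|v Av]; last first.
    exists [:: v]; first by move=> x; rewrite inE => /eqP ->.
    by apply: span_sub; rewrite /= mem_head.
  split; first by exists [::] => //; apply: (submod0 (span_is_submodule _)).
  move=> a x y [s sA sx] [s' sA' sy]; exists (s ++ s').
    by move=> z; rewrite mem_cat => /orP[/sA|/sA'].
  by apply/span_seq_cat; exists (a *: x), y; split=> //; apply: (submodZ _ (span_is_submodule _)).
have [s sA sU] : exists2 s : seq W, {in s, forall v, A v} & {in us, forall u, span [set` s] u}.
  have : {in us, forall u, span A u} by move=> u uu; rewrite -usE; apply: span_sub.
  elim: (us) => [|u l IHl] ul; first by exists [::].
  have [|s sA sl] := IHl; first by move=> b bl; apply: ul; rewrite inE bl orbT.
  have [|s' s'A s'u] := one u; first by apply: ul; rewrite mem_head.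
  exists (s' ++ s); first by move=> z; rewrite mem_cat => /orP[/s'A|/sA].
  move=> x; rewrite inE => /orP[/eqP ->|/sl sx]; apply/span_seq_cat.
    by exists u, 0; split=> //; [apply: (submod0 (span_is_submodule _))|rewrite addr0].
  by exists 0, x; split=> //; [apply: (submod0 (span_is_submodule _))|rewrite add0r].
exists s => //; apply/seteqP; split; first exact: span_mono.
by rewrite -usE; apply: span_min => //; apply: span_is_submodule.
Qed.

(** The union of a chain of ideals is finitely generated, hence equal to one
of them, so that Zorn's lemma applies. *)
Lemma ideal_max (P : set (set R)) (I0 : set R) :
  (forall I, P I -> is_ideal I) -> P I0 ->
  exists I, [/\ P I, I0 `<=` I & forall J, P J -> I `<=` J -> J = I].
Proof.
move=> idP PI0.
pose T := {I : set R | P I /\ I0 `<=` I}.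
pose rel (I J : T) := `[< sval I `<=` sval J >].
have [|I J K|I J|F tF|Im Imax] := @Zorn T rel.
- by move=> I; apply/asboolP.
- by move=> /asboolP IJ /asboolP JK; apply/asboolP; apply: subset_trans IJ JK.
- move=> /asboolP IJ /asboolP JI.
  case: I J IJ JI => [I pI] [J pJ] /= IJ JI.
  have E : I = J by apply/seteqP.
  by case: _ / E in pJ IJ JI *; congr exist; apply: Prop_irrelevance.
- have [[I1 FI1]|F0] := pselect (exists I, F I); last first.
    by exists (exist _ I0 (conj PI0 (fun _ => id))) => I FI; case: F0; exists I.
  pose U : set R := [set a | exists2 I : T, F I & sval I a].
  have sU : is_ideal U.
    split; first by exists I1 => //; apply: (submod0 (idP _ (svalP I1).1)).
    move=> c a b [I FI Ia] [J FJ Jb].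
    have [/asboolP IJ|/asboolP JI] := tF I J FI FJ.
      exists J => //; case: (idP _ (svalP J).1) => _; apply=> //; exact: IJ.
    exists I => //; case: (idP _ (svalP I).1) => _; apply=> //; exact: JI.
  have [s sE] := noeth sU.
  have [I FI sI] : exists2 I : T, F I & {in s, forall a, sval I a}.
    have : {in s, forall a, U a} by move=> a sa; rewrite -sE; apply: span_sub.
    elim: (s) => [|a l IHl] al; first by exists I1.
    have [|I FI lI] := IHl; first by move=> b bl; apply: al; rewrite inE bl orbT.
    have [|J FJ Ja] := al a; first by rewrite mem_head.
    have [/asboolP IJ|/asboolP JI] := tF I J FI FJ.
      by exists J => // x; rewrite inE => /orP[/eqP ->//|/lI]; apply: IJ.
    by exists I => // x; rewrite inE => /orP[/eqP ->|/lI//]; apply: JI.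
  exists I => J FJ; apply/asboolP => a Ja.
  have : U a by exists J.
  by rewrite -sE; apply: span_min => //; apply: (idP _ (svalP I).1).
- exists (sval Im); case: (svalP Im) => PIm I0Im; split=> // J PJ IJ.
  have pJ : P J /\ I0 `<=` J by split=> //; apply: subset_trans IJ.
  by have /= <- := congr1 sval (Imax (exist _ J pJ) (asboolT IJ)).
Qed.

End Noetherian.

(** * Local rings *)

Section LocalRing.
Variables (R : comNzRingType) (m : set R).

(** If a is not a unit, a maximal member among the proper ideals containing a
is a maximal ideal, that is, m. *)
Lemma local_ringP : is_local m -> noetherian R ->
  [/\ is_ideal m, ~ m 1 & forall a, ~ m a -> exists b, b * a = 1].
Proof.
move=> [[mI mT _] mU] noeth; split=> //.
  move=> m1; apply: mT; apply/seteqP; split=> // a _.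
  by have := submodZ a mI m1; rewrite /= [_ *: _]mulr1.
move=> a nma; apply: contrapT => nb.
pose P (I : set R) := is_ideal I /\ ~ I 1.
have [||I [[idI I1] aI Imax]] := @ideal_max _ noeth P [set c | exists b, c = b * a].
- by move=> I [].
- split; last by move=> [b b1]; apply: nb; exists b.
  split; first by exists 0; rewrite mul0r.
  move=> c _ _ [b ->] [b' ->]; exists (c * b + b').
  by rewrite mulrDl -mulrA.
suff : maximal_ideal I.
  by move/mU => Im; apply: nma; rewrite -Im; apply: aI; exists 1; rewrite mul1r.
split=> // [IT|J idJ IJ]; first by apply: I1; rewrite IT.
have [J1|J1] := pselect (J 1); last by left; apply: Imax.
right; apply/seteqP; split=> // c _.
by have := submodZ c idJ J1; rewrite /= [_ *: _]mulr1.
Qed.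

Hypothesis noeth : noetherian R.
Hypothesis mI : is_ideal m.
Hypothesis m1 : ~ m 1.
Hypothesis unitm : forall a, ~ m a -> exists b, b * a = 1.

Let m0 : m 0. Proof. exact: (submod0 mI). Qed.
Let mD a b : m a -> m b -> m (a + b). Proof. exact: (submodD mI). Qed.
Let mMl a b : m b -> m (a * b). Proof. exact: (submodZ a mI). Qed.

Lemma unit_sub1 a : m a -> exists b, b * (1 - a) = 1.
Proof.
move=> ma; apply: unitm => m1a; apply: m1.
by rewrite -(subrK a 1); apply: mD.
Qed.

(** Generators are discarded one at a time: if u and us generate U modulo S,
then u = b u + (an element of S + span us) with b in m, and 1 - b is a unit. *)
Lemma nakayama (W : lmodType R) (S U : set W) : is_submodule S -> fg_set U ->
  (forall u, U u -> sumset S (ideal_smul m U) u) -> U `<=` S.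
Proof.
move=> sS [us usE] USm.
have sU : is_submodule U by rewrite -usE; apply: span_is_submodule.
have : {in us, forall u, U u} by move=> u uu; rewrite -usE; apply: span_sub.
have : U `<=` sumset S (span [set` us]).
  by rewrite usE => u Uu; apply: sumsetr.
elim: us {usE} => [|u us IH] Uus usU.
  by move=> w /Uus[x [y [Sx /span_seq_nil -> ->]]]; rewrite addr0.
apply: IH => [|w wus]; last by apply: usU; rewrite inE wus orbT.
have sUs := span_is_submodule [set` us].
set S' := sumset S (span [set` us]); have sS' : is_submodule S' by apply: sumset_submod.
have dec w : U w -> exists b s, S' s /\ w = b *: u + s.
  move=> /Uus[x [_ [Sx /span_seq_cons[a [y [Uy ->]]] ->]]].
  by exists a, (x + y); split; [exists x, y|rewrite addrCA].
have mdec w : ideal_smul m U w -> exists b s, [/\ m b, S' s & w = b *: u + s].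
  move: w; refine (span_ind _ _).
    split; first by exists 0, 0; split; [exact: m0|exact: (submod0 sS')|rewrite scale0r addr0].
    move=> a _ _ [b [s [mb Ss ->]]] [b' [s' [mb' Ss' ->]]].
    exists (a * b + b'), (a *: s + s'); split; first by apply: mD => //; apply: mMl.
      by apply: (submodD sS') => //; apply: (submodZ _ sS').
    by rewrite scalerDr scalerDl scalerA !addrA; congr (_ + _); rewrite addrAC.
  move=> _ [a [v [ma /dec[b [s [Ss ->]]] ->]]].
  exists (b * a), (a *: s); split; [exact: mMl|exact: (submodZ _ sS')|].
  by rewrite scalerDr scalerA mulrC.
have S'u : S' u.
  have [x [y [Sx /mdec[b [s [mb Ss yE]]] uE]]] := USm _ (usU u (mem_head _ _)).
  have [c cE] := unit_sub1 mb.
  suff /(submodZ c sS') : S' ((1 - b) *: u) by rewrite scalerA cE scale1r.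
  rewrite scalerBl scale1r {1}uE yE.
  rewrite addrCA [_ + (x + s)]addrC addrK.
  by apply: (submodD sS') => //; apply: sumsetl.
by move=> w /dec[b [s [Ss ->]]]; apply: (submodD sS') => //; apply: (submodZ _ sS').
Qed.

Lemma nakayamaT (W : lmodType R) (S : set W) : is_submodule S ->
  finitely_generated W -> (forall u, sumset S (ideal_smul m setT) u) -> S = setT.
Proof.
move=> sS fgW H; apply/seteqP; split=> //.
by apply: nakayama => //; apply: (submod_fg noeth).
Qed.

(** * Zero divisors, depth and common regular sequences *)

Definition ann (W : lmodType R) (S : set W) v : set R := [set a | S (a *: v)].

Lemma ann_ideal (W : lmodType R) (S : set W) v : is_submodule S -> is_ideal (ann S v).
Proof.
move=> sS; split; first by rewrite /ann /= scale0r; apply: submod0.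
by move=> a x y Sx Sy; rewrite /ann /= scalerDl -scalerA; apply: (submodD sS) => //; apply: submodZ.
Qed.

Definition prime_ideal (I : set R) :=
  [/\ is_ideal I, ~ I 1 & forall a b, I (a * b) -> I a \/ I b].

(** If a b kills v but b does not, then the annihilator of b v contains that of
v, hence equals it, and a kills v. *)
Lemma ann_max_prime (W : lmodType R) (S : set W) v : is_submodule S -> ~ S v ->
  (forall b, ~ S (b *: v) -> ann S v `<=` ann S (b *: v) -> ann S (b *: v) = ann S v) ->
  prime_ideal (ann S v).
Proof.
move=> sS nSv vmax; split; first exact: ann_ideal.
  by rewrite /ann /= scale1r.
move=> a b ab; have [Sb|nSb] := pselect (S (b *: v)); [by right|left].
rewrite -(vmax b) // => [|c Sc]; first by rewrite /ann /= scalerA.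
by rewrite /ann /= scalerA mulrC -scalerA; apply: submodZ.
Qed.

Lemma ann_max_above (W : lmodType R) (S : set W) w : is_submodule S -> ~ S w ->
  exists v, [/\ ~ S v, ann S w `<=` ann S v &
    forall u, ~ S u -> ann S v `<=` ann S u -> ann S u = ann S v].
Proof.
move=> sS nSw.
have [||_ [[v nSv ->] wv vmax]] := @ideal_max _ noeth
  [set I | exists2 v, ~ S v & I = ann S v] (ann S w).
- by move=> _ [v _ ->]; apply: ann_ideal.
- by exists w.
by exists v; split=> // u nSu vu; apply: vmax => //; exists u.
Qed.

(** The vectors with a maximal annihilator span a finitely generated submodule,
so each of them, v, is a combination of finitely many, v_1, ..., v_r. The
intersection of the primes ann v_i is then contained in the prime ann v, so some
ann v_i is contained in ann v, and equal to it by maximality. *)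
Lemma zero_divisors (W : lmodType R) (S : set W) :
  finitely_generated W -> is_submodule S ->
  exists s : seq W,
    {in s, forall v, ~ S v /\ prime_ideal (ann S v)} /\
    forall a, ~ regmod S a -> exists2 v, v \in s & ann S v a.
Proof.
move=> fgW sS.
pose A : set W := [set v | ~ S v /\
  forall u, ~ S u -> ann S v `<=` ann S u -> ann S u = ann S v].
have [s sA sE] := span_finite_sub noeth A fgW.
have Apr v : A v -> prime_ideal (ann S v) by move=> [nSv vmax]; apply: ann_max_prime => // b; apply: vmax.
exists s; split; first by move=> v /sA Av; split; [case: Av|exact: Apr].
move=> a /existsNP[w /not_implyP[Saw nSw]].
have [v [nSv wv vmax]] := ann_max_above sS nSw.
have Av : A v by [].
have [_ _ vpr] := Apr _ Av.
have cov (l : seq W) : (exists2 u, u \in l & ann S u `<=` ann S v) \/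
    exists b, ~ ann S v b /\ {in l, forall u, S (b *: u)}.
  elim: l => [|u l [[u' u'l u'v]|[b [nb bl]]]].
  - by right; exists 1; split=> //; rewrite /ann /= scale1r.
  - by left; exists u' => //; rewrite inE u'l orbT.
  have [uv|/existsNP[c /not_implyP[Sc nc]]] := pselect (ann S u `<=` ann S v).
    by left; exists u => //; rewrite mem_head.
  right; exists (b * c); split; first by case/vpr.
  move=> x; rewrite inE => /orP[/eqP ->|/bl Sb].
    by rewrite -scalerA; apply: (submodZ _ sS).
  by rewrite mulrC -scalerA; apply: (submodZ _ sS).
have [[u us uv]|[b [nb bs]]] := cov s.
  exists u => //; have [_ umax] := sA _ us.
  by rewrite -(umax v) //; apply: wv.
case: nb; have : span [set` s] v by rewrite sE; apply: span_sub.
move: v {nSv wv vmax Av vpr cov}; refine (span_ind _ _); last exact: bs.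
split; first by rewrite /ann /= scaler0; apply: submod0.
move=> c x y Sx Sy; rewrite /ann /= scalerDr scalerA mulrC -scalerA.
by apply: (submodD sS) => //; apply: (submodZ _ sS).
Qed.

(** A prime contained in the first one of the list can be dropped. If there is
none, some c lies in all the primes but the first, and an element a that avoids
all the primes but the first is corrected to a + c b with b outside the first. *)
Lemma prime_avoidance (T : eqType) (s : seq T) (p : T -> set R) (I : set R) :
  is_ideal I -> {in s, forall i, prime_ideal (p i)} ->
  (exists2 i, i \in s & I `<=` p i) \/ exists a, I a /\ {in s, forall i, ~ p i a}.
Proof.
move=> idI; have [n] := ubnP (size s).
elim: n s => // n IH [|i s] sn pr.
  by right; exists 0; split=> //; apply: (submod0 idI).
have prs : {in s, forall i, prime_ideal (p i)}.
  by move=> j js; apply: pr; rewrite inE js orbT.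
have [[j js ji]|nji] := pselect (exists2 j, j \in s & p j `<=` p i).
  have sub k : k \in i :: rem j s -> k \in i :: s.
    by rewrite !inE => /orP[->//|/mem_rem ->]; rewrite orbT.
  have [||[k ks Ik]|[a [Ia na]]] := IH (i :: rem j s).
  - by rewrite /= size_rem //; case: (s) js sn.
  - by move=> k /sub; apply: pr.
  - by left; exists k => //; apply: sub.
  right; exists a; split=> // k; rewrite inE => /orP[/eqP ->|ks].
    by apply: na; rewrite mem_head.
  have [->|kj] := eqVneq k j; first by move/ji; apply: na; rewrite mem_head.
  by apply: na; rewrite inE orbC (rem_mem kj).
have [||[k ks Ik]|[a [Ia na]]] := IH s => //.
  by left; exists k => //; rewrite inE ks orbT.
have [idi pi1 primei] := pr i (mem_head _ _).
have [pia|npia] := pselect (p i a); last first.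
  by right; exists a; split=> // k; rewrite inE => /orP[/eqP ->//|/na].
have [Ii|/existsNP[b /not_implyP[Ib nb]]] := pselect (I `<=` p i).
  by left; exists i => //; rewrite mem_head.
have [c [nc cs]] : exists c, ~ p i c /\ {in s, forall j, p j c}.
  elim: s nji prs {pr IH sn na} => [|j s IHs] nji prs; first by exists 1.
  have [||c [nc cs]] := IHs.
  - by move=> [k ks ki]; apply: nji; exists k => //; rewrite inE ks orbT.
  - by move=> k ks; apply: prs; rewrite inE ks orbT.
  have /existsNP[d /not_implyP[pd nd]] : ~ p j `<=` p i.
    by move=> ji; apply: nji; exists j => //; rewrite mem_head.
  exists (c * d); split; first by case/primei.
  move=> k ks; have [idk _ _] := prs k ks; move: ks.
  rewrite inE => /orP[/eqP kj|/cs pc]; last by rewrite mulrC; apply: (submodZ _ idk).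
  by rewrite kj in idk *; apply: (submodZ _ idk).
right; exists (a + c * b); split.
  by apply: (submodD idI) => //; apply: (submodZ _ idI).
move=> k; rewrite inE => /orP[/eqP ->|ks].
  by move/(submodDr _ idi pia) => /primei[].
have [idk _ _] := prs k ks.
rewrite addrC => /(submodDr _ idk); move=> H; apply: (na k ks); apply: H.
by rewrite mulrC; apply: (submodZ _ idk); apply: cs.
Qed.

(** Hom(k, W/S) <> 0, where k is the residue field. *)
Definition has_socle (W : lmodType R) (S : set W) :=
  exists2 v, ~ S v & forall a, m a -> S (a *: v).

(** Otherwise m is covered by the finitely many primes of zero divisors of W1/S1
and W2/S2, hence is contained in one of them, which is the annihilator of a
vector. *)
Lemma regular_element2 (W1 W2 : lmodType R) (S1 : set W1) (S2 : set W2) :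
  finitely_generated W1 -> is_submodule S1 -> ~ has_socle S1 ->
  finitely_generated W2 -> is_submodule S2 -> ~ has_socle S2 ->
  exists x, [/\ m x, regmod S1 x & regmod S2 x].
Proof.
move=> fg1 sS1 ns1 fg2 sS2 ns2.
have [s1 [pr1 zd1]] := zero_divisors fg1 sS1.
have [s2 [pr2 zd2]] := zero_divisors fg2 sS2.
pose p (i : W1 + W2) := match i with inl v => ann S1 v | inr v => ann S2 v end.
have [|[i]|[x [mx nx]]] :=
  @prime_avoidance _ ([seq inl v | v <- s1] ++ [seq inr v | v <- s2]) p m mI.
- by move=> i; rewrite mem_cat => /orP[]/mapP[v vs ->]; [case: (pr1 v vs)|case: (pr2 v vs)].
- rewrite mem_cat => /orP[]/mapP[v vs ->] /= mv.
    by case: ns1; exists v => //; case: (pr1 v vs).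
  by case: ns2; exists v => //; case: (pr2 v vs).
exists x; split=> //; apply: contrapT.
  move=> /zd1[v vs av]; apply: (nx (inl v)) => //.
  by rewrite mem_cat map_f.
move=> /zd2[v vs av]; apply: (nx (inr v)) => //.
by rewrite mem_cat map_f ?orbT.
Qed.

Fixpoint has_regs (W : lmodType R) n (S : set W) : Prop :=
  if n is k.+1 then exists x, [/\ m x, regmod S x & has_regs k (add_mul S x)] else True.

Lemma regular_no_socle (W : lmodType R) (S : set W) x : m x -> regmod S x -> ~ has_socle S.
Proof. by move=> mx rx [v nSv mv]; apply: nSv; apply: rx; apply: mv. Qed.

(** The socles of W/(S + xW) and W/(S + yW) are both Ext^1(k, W/S): a class v in
the second corresponds to the class w in the first for which x v = y w modulo
S. *)
Lemma socle_swap (W : lmodType R) (S : set W) x y : is_submodule S ->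
  m x -> m y -> regmod S x -> regmod S y ->
  has_socle (add_mul S y) -> has_socle (add_mul S x).
Proof.
move=> sS mx my rx ry [v nv mv].
have [u [w [Su xvE]]] := mv x mx.
exists w => [[u' [w' [Su' wE]]]|a ma].
  apply: nv; exists (v - y *: w'), w'; split; last by rewrite subrK.
  apply: rx; rewrite scalerBr xvE wE scalerDr !scalerA mulrC addrA addrK.
  by apply: (submodD sS) => //; apply: (submodZ _ sS).
have [u1 [v1 [Su1 avE]]] := mv a ma.
exists (a *: w - x *: v1), v1; split; last by rewrite subrK.
apply: ry; have yw : y *: w = x *: v - u by rewrite xvE addrC addKr.
have yv1 : y *: v1 = a *: v - u1 by rewrite avE addrC addKr.
rewrite scalerBr !scalerA (mulrC y a) (mulrC y x) -!scalerA yw yv1 !scalerBr.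
rewrite !scalerA (mulrC x a) opprB addrC addrA subrK.
by apply: (submodB sS); apply: (submodZ _ sS).
Qed.

Lemma regular_swap_quot (W : lmodType R) (S : set W) x z : is_submodule S ->
  regmod S x -> regmod (add_mul S x) z -> regmod (add_mul S z) x.
Proof.
move=> sS rx rz w [u [w' [Su xwE]]].
have : add_mul S x (z *: w').
  exists (- u), w; split; first exact: submodN.
  by rewrite xwE addKr.
move=> /rz[u' [w'' [Su' w'E]]].
exists (w - z *: w''), w''; split; last by rewrite subrK.
apply: rx; rewrite scalerBr xwE w'E scalerDr !scalerA mulrC addrA addrK.
by apply: (submodD sS) => //; apply: (submodZ _ sS).
Qed.

(** Depth drops by at most one modulo an arbitrary regular element x. If y starts
a regular sequence of length n + 2, the quotients by y and x have no socle, so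
some z is regular on both. The claim for W/yW and z gives a sequence on
W/(y, z)W, which y extends to W/zW; the claim for W/zW and x gives one on
W/(x, z)W, which z extends to W/xW. *)
Lemma has_regs_quot (W : lmodType R) n (S : set W) x : is_submodule S ->
  finitely_generated W -> has_regs n.+1 S -> m x -> regmod S x -> has_regs n (add_mul S x).
Proof.
elim: n S x => // n IH S x sS fgW [y [my ry hy]] mx rx.
have [z0 [mz0 rz0 _]] := hy.
have nsy := regular_no_socle mz0 rz0.
have nsx : ~ has_socle (add_mul S x) by move=> h; apply: nsy; apply: (socle_swap sS my mx ry rx).
have [z [mz rzx rzy]] :=
  regular_element2 fgW (add_mul_submod x sS) nsx fgW (add_mul_submod y sS) nsy.
exists z; split=> //.
have h1 := IH _ z (add_mul_submod y sS) fgW hy mz rzy.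
rewrite add_mulC; apply: IH => //; first exact: add_mul_submod.
  exists y; split=> //; first exact: (regular_swap_quot sS ry rzy).
  by rewrite add_mulC.
exact: (regular_swap_quot sS rx rzx).
Qed.

Lemma common_regs (W1 W2 : lmodType R) n (S1 : set W1) (S2 : set W2) :
  finitely_generated W1 -> is_submodule S1 -> has_regs n S1 ->
  finitely_generated W2 -> is_submodule S2 -> has_regs n S2 ->
  exists xs : seq R, [/\ size xs = n, {in xs, forall x, m x}, regs S1 xs & regs S2 xs].
Proof.
move=> fg1 + + fg2; elim: n S1 S2 => [|n IH] S1 S2 sS1 h1 sS2 h2; first by exists [::].
have ns1 : ~ has_socle S1 by case: h1 => x [mx rx _]; apply: regular_no_socle mx rx.
have ns2 : ~ has_socle S2 by case: h2 => x [mx rx _]; apply: regular_no_socle mx rx.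
have [x [mx r1 r2]] := regular_element2 fg1 sS1 ns1 fg2 sS2 ns2.
have [||||xs [sz mxs rs1 rs2]] := IH (add_mul S1 x) (add_mul S2 x).
- exact: add_mul_submod.
- exact: (has_regs_quot sS1).
- exact: add_mul_submod.
- exact: (has_regs_quot sS2).
exists (x :: xs); split=> //=; first by rewrite sz.
by move=> y; rewrite inE => /orP[/eqP ->//|/mxs].
Qed.

Lemma span_seq_smul (W : lmodType R) (xs : seq R) :
  span (seq_smul (M := W) xs) = add_muls [set 0] xs.
Proof.
have sA := add_muls_submod xs (@submod_set0 R W).
apply/seteqP; split.
  apply: span_min => // _ [x [w [xxs ->]]].
  elim: xs [set 0] x w xxs (@submod_set0 R W) {sA} => // y xs IH S x w + sS.
  rewrite inE => /orP[/eqP ->|xxs] /=; last by apply: IH => //; apply: add_mul_submod.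
  have sub (T : set W) zs : T `<=` add_muls T zs.
    by elim: zs T => [|z zs IHz] T w' Tw' //; apply/IHz/sub_add_mul.
  by apply: sub; apply: scale_add_mul.
have sub : {in xs, forall x, forall w : W, span (seq_smul xs) (x *: w)}.
  by move=> x xxs w; apply: span_sub; exists x, w.
have : [set 0] `<=` span (seq_smul (M := W) xs).
  by move=> _ ->; apply: (submod0 (span_is_submodule _)).
move: (span _) (span_is_submodule (seq_smul (M := W) xs)) sub {sA} => T sT.
elim: xs [set 0] => //= y xs IH S sub ST; apply: IH.
  by move=> x xxs w; apply: sub; rewrite inE xxs orbT.
move=> _ [u [w [Su ->]]]; apply: (submodD sT); first exact: ST.
by apply: sub; rewrite mem_head.
Qed.

Lemma regmodP (W : lmodType R) (A : set W) x :
  (forall v : quotmod A, x *: v = 0 -> v = 0) <-> regmod (span A) x.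
Proof.
have pi0 v : quotmod_pi A v = 0 <-> span A v.
  have -> : 0 = quotmod_pi A 0.
    by apply: (addrI (quotmod_pi A 0)); rewrite -quotmod_piD !addr0.
  by rewrite quotmod_eqP subr0.
split=> [H v /pi0|H v].
  by rewrite quotmod_piZ => /H /pi0.
have [w ->] := quotmod_piP v.
have <- : quotmod_pi A (x *: w) = x *: quotmod_pi A w by exact: quotmod_piZ.
by move=> /pi0/H/pi0.
Qed.

Lemma regular_seqP (W : lmodType R) (xs : seq R) :
  (forall i, (i < size xs)%N ->
     forall v : quotmod (seq_smul (M := W) (take i xs)), xs`_i *: v = 0 -> v = 0) <->
  regs [set (0 : W)] xs.
Proof.
elim/last_ind: xs => [|xs x IH]; first by split.
split=> [H|/regs_rcons[/IH rxs rx] i].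
  apply/regs_rcons; split.
    apply/IH => i ixs; have := H i; rewrite size_rcons ltnS ltnW // => /(_ isT).
    by rewrite nth_rcons ixs -cats1 takel_cat ?(ltnW ixs).
  have := H (size xs); rewrite size_rcons leqnn => /(_ isT) /regmodP.
  by rewrite nth_rcons ltnn eqxx span_seq_smul -cats1 take_size_cat.
rewrite size_rcons ltnS leq_eqVlt => /orP[/eqP ->|ixs].
  apply/regmodP.
  by rewrite nth_rcons ltnn eqxx span_seq_smul -cats1 take_size_cat.
by rewrite nth_rcons ixs -cats1 takel_cat ?(ltnW ixs) //; apply: rxs.
Qed.

Lemma regs_has_regs (W : lmodType R) n (S : set W) xs :
  (n <= size xs)%N -> {in xs, forall x, m x} -> regs S xs -> has_regs n S.
Proof.
elim: xs n S => [|x xs IH] [|n] S //= nxs mxs [rx rxs].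
exists x; split=> //; first by apply: mxs; rewrite mem_head.
by apply: IH => // y yxs; apply: mxs; rewrite inE yxs orbT.
Qed.

Lemma depth_ge_has_regs (W : lmodType R) n : depth_ge m W n -> has_regs n [set (0 : W)].
Proof.
case=> [W0|[xs [nxs mxs [/regular_seqP rxs _]]]]; last exact: (regs_has_regs nxs).
elim: n [set _] => //= n IH S; exists 0; split=> //.
by move=> v; rewrite (W0 v) scaler0.
Qed.

Lemma fgR : finitely_generated (reg R).
Proof.
exists [:: 1]; apply/seteqP; split=> // a _; apply/span_seq_cons; exists a, 0; split.
  exact: (submod0 (span_is_submodule _)).
by rewrite addr0 [_ *: _]mulr1.
Qed.

(** A regular sequence whose length is depth R cannot be extended on R, so R/(xs)
has no regular element in m, which forces a socle. *)
Lemma common_maximal_regs (L : lmodType R) t : depth_eq m (reg R) t ->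
  depth_ge m L t -> finitely_generated L ->
  exists xs : seq R, [/\ {in xs, forall x, m x}, size xs = t,
    regs [set (0 : reg R)] xs, regs [set (0 : L)] xs &
    has_socle (add_muls [set (0 : reg R)] xs)].
Proof.
move=> [hR nhR] hL fgL.
have [xs [sz mxs rR rL]] := common_regs fgR (submod_set0 _) (depth_ge_has_regs hR)
  fgL (submod_set0 _) (depth_ge_has_regs hL).
exists xs; split=> //; apply: contrapT => ns; apply: nhR; right.
have sA := add_muls_submod xs (submod_set0 (reg R)).
have [x [mx rx _]] := regular_element2 fgR sA ns fgR sA ns.
exists (rcons xs x); rewrite size_rcons sz; split=> //.
  by move=> y; rewrite mem_rcons inE => /orP[/eqP ->//|/mxs].
split; first by apply/regular_seqP/regs_rcons.
move=> /(_ (quotmod_pi _ 1)).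
have -> : 0 = quotmod_pi (seq_smul (M := R^o) (rcons xs x)) 0.
  by apply: (addrI (quotmod_pi _ 0)); rewrite -quotmod_piD !addr0.
move=> /quotmod_eqP; rewrite subr0 => h; apply: m1.
move: h; apply: span_min => // _ [y [w [yxs ->]]].
rewrite [_ *: _]mulrC; apply: mMl.
by move: yxs; rewrite mem_rcons inE => /orP[/eqP ->//|/mxs].
Qed.

End LocalRing.

(** * Linear maps and projective modules *)

Section LinearTools.
Variables (R : comNzRingType).
Implicit Types (U V W : lmodType R).

Lemma exists_linear U V (f : U -> V) : linear f -> exists g : {linear U -> V}, g =1 f.
Proof.
move=> lf.
by exists (HB.pack f (GRing.isLinear.Build R U V *:%R f lf) : {linear U -> V}).
Qed.

Lemma surj_ex U V (f : {linear U -> V}) : range f = setT -> forall v, exists u, f u = v.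
Proof. by move=> fT v; have [u _ <-] : range f v by [rewrite fT]; exists u. Qed.

Lemma surj_range U V (f : {linear U -> V}) : (forall v, exists u, f u = v) -> range f = setT.
Proof. by move=> fs; apply/seteqP; split=> // v _; have [u <-] := fs v; exists u. Qed.

Lemma factor_surj U V W (p : {linear U -> V}) (f : {linear U -> W}) :
  (forall v, exists u, p u = v) -> (forall u, p u = 0 -> f u = 0) ->
  exists h : {linear V -> W}, forall u, h (p u) = f u.
Proof.
move=> ps pf; pose s v := sval (cid (ps v)).
have sE v : p (s v) = v by rewrite /s; case: cid.
have fE u u' : p u = p u' -> f u = f u'.
  by move=> E; apply/eqP; rewrite -subr_eq0 -linearB pf // linearB E subrr.
have [|h hE] := @exists_linear V W (fun v => f (s v)).
  by move=> a x y; rewrite -linearP; apply: fE; rewrite linearP !sE.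
by exists h => u; rewrite hE; apply: fE; rewrite sE.
Qed.

(** The fibre product of g and h maps onto P; a section of it, which exists as P
is projective, has f as its first component. *)
Lemma proj_lift (P : lmodType R) U V (g : {linear U -> V}) (h : {linear P -> V}) :
  is_projective P -> (forall x, exists u, g u = h x) ->
  exists f : {linear P -> U}, forall x, g (f x) = h x.
Proof.
move=> projP gh.
have [|d dE] := @exists_linear (U * P)%type V (fun z => g z.1 - h z.2).
  by move=> a x y; rewrite /= !linearP /= scalerBr addrACA scalerN.
have [|q qE] := @exists_linear (kernel d) P (fun z => (val z).2).
  by move=> a x y; rewrite !linearP.
have [|s sE] := projP _ _ q idfun.
  apply: surj_range => x; have [u ux] := gh x.
  have k : (u, x) \in ker_mem d by rewrite unfold_in /= dE /= ux subrr.
  by exists (exist _ (u, x) k); rewrite qE.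
have [|f fE] := @exists_linear P U (fun x => (val (s x)).1).
  by move=> a x y; rewrite !linearP.
exists f => x; rewrite fE; have := valP (s x); rewrite unfold_in dE.
by rewrite -qE sE subr_eq0 => /eqP.
Qed.

Lemma quot_lin W (S : set W) : exists p : {linear W -> quotmod S},
  [/\ p =1 quotmod_pi S, forall v, exists u, p u = v & forall u, p u = 0 <-> span S u].
Proof.
have [|p pE] := @exists_linear W (quotmod S) (quotmod_pi S).
  by move=> a x y; rewrite quotmod_piD; congr (_ + _); apply: quotmod_piZ.
exists p; split=> [//|v|u]; first by have [u ->] := quotmod_piP v; exists u.
by rewrite -(linear0 p) !pE quotmod_eqP subr0.
Qed.

Lemma span_id W (S : set W) : is_submodule S -> span S = S.
Proof. by move=> sS; apply/seteqP; split; [apply: span_min|apply: span_sub]. Qed.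

Lemma range_submod U V (f : {linear U -> V}) : is_submodule (range f).
Proof. exact: image_submod. Qed.

Lemma proj_lift_quot (P : lmodType R) W (S : set W) (f : {linear P -> W}) x :
  is_projective P -> is_submodule S -> (forall y, add_mul S x (f y)) ->
  exists g : {linear P -> W}, forall y, S (f y - x *: g y).
Proof.
move=> projP sS fS; have [p [pE ps p0]] := quot_lin S.
have [|xp xpE] := @exists_linear W _ (fun w => p (x *: w)).
  by move=> a u v; rewrite scalerDr scalerA mulrC -scalerA linearP.
have [|pf pfE] := @exists_linear P _ (fun y => p (f y)).
  by move=> a u v; rewrite !linearP.
have [|g gE] := @proj_lift P _ _ xp pf projP.
  move=> y; have [u [v [Su fE]]] := fS y; exists v.
  rewrite xpE pfE fE linearD.
  by rewrite ((p0 u).2 (span_sub Su)) add0r.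
exists g => y; rewrite -(span_id sS); apply/p0.
by rewrite linearB -xpE gE pfE subrr.
Qed.

End LinearTools.

(** * Maps out of a faithful module *)

Section Faithful.
Variables (R : comNzRingType) (noeth : noetherian R) (C : lmodType R).

Definition faithful := forall a : R, (forall c : C, a *: c = 0) -> a = 0.

Hypotheses (fgC : finitely_generated C) (faithC : faithful).

(** Let k be a multiple of w with prime annihilator p modulo S. Among the
suffixes l of a list of generators of C, take the shortest u :: l for which some
a outside p sends C into its span: the empty list is impossible because C is
faithful. Write a c = r(c) u modulo span l. Then r(c) is well defined modulo p,
since r u in span l with r outside p would make l itself admissible, and the map
is c |-> r(c) k; it sends u to a k <> 0. *)
Lemma Hom_quot_neq0 (W : lmodType R) (S : set W) w : is_submodule S -> ~ S w ->
  exists f : {linear C -> quotmod S},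
    (forall c, exists r, f c = quotmod_pi S (r *: w)) /\ exists c, f c <> 0.
Proof.
move=> sS nSw.
have [||_ [[r0 nSk ->] _ kmax]] := @ideal_max _ noeth
  [set I | exists2 r, ~ S (r *: w) & I = ann S (r *: w)] (ann S w).
- by move=> _ [v _ ->]; apply: ann_ideal.
- by exists 1; rewrite scale1r.
set k := r0 *: w in nSk kmax.
have [idp p1 pr] : prime_ideal (ann S k).
  apply: ann_max_prime => // b nb kb; apply: kmax => //.
  by exists (b * r0); rewrite -scalerA.
have [cs csE] := fgC.
have : exists a, ~ ann S k a /\ forall c : C, span [set` cs] (a *: c).
  by exists 1; split=> // c; rewrite csE.
elim: cs {csE} => [|u l IH] [a [na aC]].
  case: na; have -> : a = 0 by apply: faithC => c; apply: span_seq_nil (aC c).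
  exact: (submod0 idp).
have [/IH//|nD] := pselect (exists a, ~ ann S k a /\ forall c : C, span [set` l] (a *: c)).
have sl := span_is_submodule [set` l].
have ex c : exists r, span [set` l] (a *: c - r *: u).
  have /span_seq_cons[r [y [ly acE]]] := aC c.
  by exists r; rewrite acE addrC addKr.
have uniq r : span [set` l] (r *: u) -> ann S k r.
  move=> lr; apply: contrapT => nr; apply: nD; exists (r * a); split.
    by case/pr.
  move=> c; have [s ls] := ex c.
  rewrite -(subrK (r *: (s *: u)) ((r * a) *: c)); apply: (submodD sl).
    by rewrite -scalerA -scalerBr; apply: (submodZ _ sl).
  by rewrite scalerA mulrC -scalerA; apply: (submodZ _ sl).
have [p [pE ps p0]] := quot_lin S.
pose rho c := sval (cid (ex c)).
have rhoE c r : span [set` l] (a *: c - r *: u) -> S ((rho c - r) *: k).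
  move=> lr; apply: uniq; rewrite /rho; case: cid => s /= ls.
  have /(submodB sl lr) := ls.
  by rewrite opprB [_ - r *: u]addrC addrACA subrr addr0 addrC -scalerBl.
have pS x y : S (x - y) -> quotmod_pi S x = quotmod_pi S y.
  by move=> Sxy; apply/quotmod_eqP; apply: span_sub.
have [|f fE] := @exists_linear R C (quotmod S) (fun c => quotmod_pi S (rho c *: k)).
  move=> b c d.
  have -> : b *: quotmod_pi S (rho c *: k) = quotmod_pi S (b *: (rho c *: k)).
    by symmetry; exact: quotmod_piZ.
  rewrite -quotmod_piD; apply: pS.
  rewrite scalerA -scalerDl -scalerBl; apply: rhoE.
  have -> : a *: (b *: c + d) - (b * rho c + rho d) *: u =
      b *: (a *: c - rho c *: u) + (a *: d - rho d *: u).
    rewrite scalerDr scalerDl opprD addrACA; congr (_ + _).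
    by rewrite scalerBr !scalerA mulrC.
  by case: sl => _; apply; rewrite /rho; case: cid.
exists f; split=> [c|]; first by exists (rho c * r0); rewrite fE scalerA.
exists u; rewrite fE => E; apply: na.
have Sr : S (rho u *: k) by rewrite -(span_id sS); apply/p0; rewrite pE.
have : S ((rho u - a) *: k) by apply: rhoE; rewrite subrr; apply: (submod0 sl).
rewrite scalerBl => Sra; rewrite /ann /=.
by rewrite -(subKr (rho u *: k) (a *: k)); apply: submodB.
Qed.

Lemma Hom_quot_lift (P : proj_resolution C) (W : lmodType R) (S : set W) w :
  is_submodule S -> ~ S w ->
  exists f : {linear res_obj P 0 -> W},
    [/\ forall y, S (f (res_diff P 0 y)), forall y, exists r, S (f y - r *: w) &
        exists y, ~ S (f y)].
Proof.
move=> sS nSw; have [h [hw [c hc]]] := Hom_quot_neq0 sS nSw.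
have [p [pE ps p0]] := quot_lin S; rewrite span_id // in p0.
have [|ha haE] := @exists_linear R (res_obj P 0) _ (fun y => h (res_aug P y)).
  by move=> a x y; rewrite !linearP.
have [//|f fE] := @proj_lift R _ _ _ p ha (@res_proj _ _ P 0).
exists f; split=> [y|y|].
- apply/p0; rewrite fE haE.
  have : range (res_diff P 0) (res_diff P 0 y) by exists y.
  by rewrite res_exact0 /= => ->; rewrite linear0.
- have [r hr] := hw (res_aug P y); exists r; apply/p0.
  by rewrite linearB fE haE hr -pE subrr.
have [y yc] := surj_ex (res_aug_surj P) c.
by exists y => /p0; rewrite fE haE yc.
Qed.

End Faithful.

(** * Semidualizing modules modulo a regular sequence *)

Section Resolutions.
Variables (R : comNzRingType).

Lemma res_diffK (M : lmodType R) (P : proj_resolution M) i y :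
  res_diff P i (res_diff P i.+1 y) = 0.
Proof.
have : range (res_diff P i.+1) (res_diff P i.+1 y) by exists y.
by rewrite res_exactS.
Qed.

Lemma res_augK (M : lmodType R) (P : proj_resolution M) y :
  res_aug P (res_diff P 0 y) = 0.
Proof.
have : range (res_diff P 0) (res_diff P 0 y) by exists y.
by rewrite res_exact0.
Qed.

Lemma res_aug_onto (M : lmodType R) (P : proj_resolution M) v :
  exists y, res_aug P y = v.
Proof. exact: (surj_ex (res_aug_surj P)). Qed.

Lemma res_aug_ker (M : lmodType R) (P : proj_resolution M) y :
  res_aug P y = 0 -> exists z, res_diff P 0 z = y.
Proof. by rewrite -[_ = 0]/([set x | res_aug P x = 0] y) -res_exact0 => -[z _ <-]; exists z. Qed.

Lemma res_diff_ker (M : lmodType R) (P : proj_resolution M) i y :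
  res_diff P i y = 0 -> exists z, res_diff P i.+1 z = y.
Proof.
by rewrite -[_ = 0]/([set x | res_diff P i x = 0] y) -res_exactS => -[z _ <-]; exists z.
Qed.

Lemma Ext0_lift (M N : lmodType R) (P : proj_resolution M) i
    (f : {linear res_obj P i.+1 -> N}) :
  Ext_eq0 i.+1 M N -> (forall y, f (res_diff P i.+1 y) = 0) ->
  exists g : {linear res_obj P i -> N}, forall y, f y = g (res_diff P i y).
Proof. by move=> /(_ P f) E /E. Qed.

Lemma descend (M N : lmodType R) (P : proj_resolution M)
    (f : {linear res_obj P 0 -> N}) :
  (forall y, f (res_diff P 0 y) = 0) ->
  exists h : {linear M -> N}, forall y, h (res_aug P y) = f y.
Proof.
move=> fd; apply: factor_surj => [v|y /res_aug_ker[z <-]//].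
exact: res_aug_onto.
Qed.

Lemma sub_homE (U V : lmodType R) (f g : {linear U -> V}) y : (f - g) y = f y - g y.
Proof. by []. Qed.

Lemma scale_homE (U V : lmodType R) a (f : {linear U -> V}) y : (a *: f) y = a *: f y.
Proof. by []. Qed.

Section SemidualizingQuotients.
Variables (noeth : noetherian R) (C : lmodType R) (sdC : semidualizing C).

Lemma sdual_faithful : faithful C.
Proof.
case: sdC => _ _ [h hK _] a aC.
have E : homothety C a = homothety C 0.
  by apply: linear_eq => c; rewrite /homothety /= aC scale0r.
by rewrite -(hK a) E hK.
Qed.

Lemma sdual_homothety (f : {linear C -> C}) : exists a, forall c, f c = a *: c.
Proof. by case: sdC => _ _ [h _ hK]; exists (h f) => c; rewrite -{1}(hK f). Qed.

Variable P : proj_resolution C.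

(** Hom(C, C/S) is generated by the homothety with annihilator I, and
Ext^i(C, C/S) = 0 for i > 0. *)
Record sdual_mod (I : set R) (S : set C) : Prop := SdualMod {
  sdm_sub : is_submodule S;
  sdm_scale : forall a c, I a -> S (a *: c);
  sdm_ext : forall i (f : {linear res_obj P i.+1 -> C}),
    (forall y, S (f (res_diff P i.+1 y))) ->
    exists g : {linear res_obj P i -> C}, forall y, S (f y - g (res_diff P i y));
  sdm_hom : forall f : {linear res_obj P 0 -> C},
    (forall y, S (f (res_diff P 0 y))) ->
    exists a, forall y, S (f y - a *: res_aug P y);
  sdm_ann : forall a, (forall c, S (a *: c)) -> I a }.

Lemma sdual_mod0 : sdual_mod [set 0] [set 0].
Proof.
case: (sdC) => _ E _; split.
- exact: submod_set0.
- by move=> a c ->; rewrite /= scale0r.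
- move=> i f fd; have [//|g gE] := Ext0_lift (E i.+1 _) fd.
  by exists g => y; rewrite /= gE subrr.
- move=> f /descend[h hE]; have [a aE] := sdual_homothety h.
  by exists a => y; rewrite /= -hE aE subrr.
- by move=> a aC; apply: sdual_faithful.
Qed.

(** First, x is regular on C/S: otherwise its kernel receives a nonzero map from
C, which is a homothety a with x a in I, hence with a in I. The rest is the long
exact Ext sequence of 0 -> C/S -> C/S -> C/(S + xC) -> 0. *)
Lemma sdual_mod_add_mul (I : set R) (S : set C) x :
  regmod (I : set R^o) x -> sdual_mod I S -> sdual_mod (add_mul (I : set R^o) x) (add_mul S x).
Proof.
move=> rI [sS IS E H U].
have fgC : finitely_generated C by case: sdC.
have rS : regmod S x.
  move=> c Sxc; apply: contrapT => nSc.
  have [f [fd fc [y0 ny0]]] := Hom_quot_lift noeth fgC sdual_faithful P sS nSc.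
  have [a fa] := H f fd.
  apply: ny0; rewrite -(subrK (a *: res_aug P y0) (f y0)).
  apply: (submodD sS) => //; apply: IS; apply: rI; apply: U => v.
  have [y <-] := res_aug_onto P v; have [r fr] := fc y.
  have /(submodZ (- x) sS) := fa y; rewrite scalerBr scaleNr scaleNr opprK.
  rewrite scalerA; move/(submodDr _ sS); apply; apply: (submodN sS).
  have /(submodZ x sS) := fr; rewrite scalerBr => Sxf.
  rewrite -(subrK (x *: (r *: c)) (x *: f y)); apply: (submodD sS) => //.
  by rewrite scalerA mulrC -scalerA; apply: submodZ.
have step i (f : {linear res_obj P i -> C}) :
    (forall y, add_mul S x (f (res_diff P i y))) ->
    exists g : {linear res_obj P i -> C}, forall y, S ((f - x *: g) (res_diff P i y)).
  move=> fd; have [//|g gE] := @proj_lift_quot R (res_obj P i.+1) _ S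
    (f \o res_diff P i) x (@res_proj _ _ P _) sS.
  have [|g' g'E] := E i g.
    move=> y; apply: rS; rewrite -[X in S X]opprK; apply: (submodN sS).
    by have := gE (res_diff P i.+1 y); rewrite /= res_diffK linear0 sub0r.
  exists g' => y; rewrite sub_homE scale_homE.
  rewrite -(subrK (x *: g y) (f _)) -addrA -scalerBr.
  by apply: (submodD sS); [apply: gE|apply: submodZ].
split.
- exact: add_mul_submod.
- move=> _ c [b [r [Ib ->]]]; exists (b *: c), (r *: c); split; first exact: IS.
  by rewrite scalerDl [in x *: r]/GRing.scale /= -scalerA.
- move=> i f /step[g /E[h hE]]; exists h => y.
  exists ((f - x *: g) y - h (res_diff P i y)), (g y); split=> //.
  by rewrite sub_homE scale_homE addrAC subrK.
- move=> f /step[g /H[a aE]]; exists a => y.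
  exists ((f - x *: g) y - a *: res_aug P y), (g y); split=> //.
  by rewrite sub_homE scale_homE addrAC subrK.
move=> a aS.
have [|g gE] := @proj_lift_quot R (res_obj P 0) _ S (a *: res_aug P) x (@res_proj _ _ P _) sS.
  by move=> y; rewrite scale_homE.
have [|b bE] := H g.
  move=> y; apply: rS; rewrite -[X in S X]opprK; apply: (submodN sS).
  by have := gE (res_diff P 0 y); rewrite scale_homE res_augK scaler0 sub0r.
exists (a - x * b), b; split; last by rewrite subrK.
apply: U => c; have [y <-] := res_aug_onto P c.
rewrite scalerBl -scalerA -(subrK (x *: g y) (a *: _)) -addrA -scalerBr.
by apply: (submodD sS); [apply: gE|apply: submodZ].
Qed.

(** R/(xs) = Hom(C, C/(xs)C) by induction along xs, starting from R = Hom(C, C). *)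
Lemma sdual_quot_faithful (xs : seq R) a : regs [set (0 : reg R)] xs ->
  (forall c : C, add_muls [set 0] xs (a *: c)) -> add_muls [set (0 : reg R)] xs a.
Proof.
move=> rxs; suff gen : forall (I : set (reg R)) (S : set C),
    regs I xs -> sdual_mod I S -> sdual_mod (add_muls I xs) (add_muls S xs).
  by case: (gen _ _ rxs sdual_mod0) => _ _ _ _; apply.
elim: xs {rxs} => //= x xs IH I S [rI rxs] h.
by apply: IH => //; apply: sdual_mod_add_mul.
Qed.

End SemidualizingQuotients.

(** * Lifting along complexes, and exactness detected by Hom(C, _) *)

Section Complexes.
Variables (G : nat -> lmodType R) (D : forall k, {linear G k.+1 -> G k}).
Hypothesis DK : forall k v, D k (D k.+1 v) = 0.

Definition exact_at l := forall v, D l v = 0 -> exists u, D l.+1 u = v.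

(** A chase along a bounded complex: each step moves the obstruction one
degree up in the resolution and one step left in the complex, where it is
finally a cocycle with values in the zero module. *)
Lemma lift_boundary (M : lmodType R) (P : proj_resolution M) n j k :
  (forall l, (k + n < l)%N -> is_zero_module (G l)) ->
  (forall l, (k <= l)%N -> exact_at l) ->
  (forall i l, (j <= i < j + n)%N -> (k < l)%N ->
    forall f : {linear res_obj P i.+1 -> G l}, (forall y, f (res_diff P i.+1 y) = 0) ->
    exists g : {linear res_obj P i -> G l}, forall y, f y = g (res_diff P i y)) ->
  forall f : {linear res_obj P j -> G k},
    (forall y, exists v, D k v = f (res_diff P j y)) ->
    exists g : {linear res_obj P j -> G k.+1},
      forall y, f (res_diff P j y) = D k (g (res_diff P j y)).
Proof.
elim: n j k => [|n IH] j k Gz Gex E f fd.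
  exists \0 => y; have [v <-] := fd y.
  by have -> : v = 0 by [apply: Gz; rewrite addn0]; rewrite !linear0.
have [|f' f'E] := proj_lift (g := D k) (h := f \o res_diff P j) (@res_proj _ _ P j.+1).
  exact: fd.
have [||||g' g'E] := IH j.+1 k.+1 _ _ _ f'.
- by move=> l; rewrite addSnnS; apply: Gz.
- by move=> l /ltnW; apply: Gex.
- move=> i l /andP[ij ijn] kl; apply: E; last exact: ltnW.
  by rewrite (ltnW ij) -addSnnS.
- by move=> y; apply: Gex => //; rewrite f'E /= res_diffK linear0.
have [|||g gE] := E j k.+1 _ _ (f' - (D k.+1 \o g' : {linear _ -> _})).
- by rewrite leqnn addnS ltnS leq_addr.
- by [].
- by move=> y; rewrite sub_homE /= g'E subrr.
exists g => y; rewrite -gE sub_homE /= linearB /= DK subr0.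
by rewrite f'E.
Qed.

(** Hence f descends to M up to D k: maps from M to the cokernel of D k lift to
G k. *)
Lemma lift_from_module (M : lmodType R) (P : proj_resolution M) n k :
  (forall l, (k + n < l)%N -> is_zero_module (G l)) ->
  (forall l, (k <= l)%N -> exact_at l) ->
  (forall i l, (i < n)%N -> (k < l)%N ->
    forall f : {linear res_obj P i.+1 -> G l}, (forall y, f (res_diff P i.+1 y) = 0) ->
    exists g : {linear res_obj P i -> G l}, forall y, f y = g (res_diff P i y)) ->
  forall f : {linear res_obj P 0 -> G k},
    (forall y, exists v, D k v = f (res_diff P 0 y)) ->
    exists (g : {linear res_obj P 0 -> G k.+1}) (h : {linear M -> G k}),
      forall y, f y = h (res_aug P y) + D k (g y).
Proof.
move=> Gz Gex E f fd.
have [|g gE] := @lift_boundary M P n 0 k Gz Gex _ f fd.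
  by move=> i l; rewrite add0n => /andP[_]; apply: E.
have [|h hE] := descend (P := P) (f := f - (D k \o g : {linear _ -> _})).
  by move=> y; rewrite sub_homE /= gE subrr.
by exists g, h => y; rewrite hE sub_homE /= subrK.
Qed.

Section Detection.
Variables (noeth : noetherian R) (C : lmodType R) (P : proj_resolution C).
Hypotheses (fgC : finitely_generated C) (faithC : faithful C) (n : nat).
Hypothesis G_bounded : forall l, (n < l)%N -> is_zero_module (G l).
Hypothesis G_acyclic : forall i l (f : {linear res_obj P i.+1 -> G l.+1}),
  (forall y, f (res_diff P i.+1 y) = 0) ->
  exists g : {linear res_obj P i -> G l.+1}, forall y, f y = g (res_diff P i y).

(** A vector of Z outside the image of D k gives a nonzero map from C to Z
modulo this image. It lifts to a map C -> Z, which factors through D k by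
hypothesis, so it was zero. *)
Lemma hom_detects_image k (Z : set (G k)) : is_submodule Z ->
  (forall v, Z (D k v)) -> (forall l, (k <= l)%N -> exact_at l) ->
  (forall h : {linear C -> G k}, (forall c, Z (h c)) ->
    exists h' : {linear C -> G k.+1}, forall c, h c = D k (h' c)) ->
  forall v, Z v -> exists u, D k u = v.
Proof.
move=> sZ DZ Gex Ch w Zw; apply: contrapT => nw.
have nSw : ~ range (D k) w by move=> [u _ uw]; apply: nw; exists u.
have [f [fd fw [y0 ny0]]] := Hom_quot_lift noeth fgC faithC P (range_submod (D k)) nSw.
have [|||g [h fE]] := @lift_from_module C P n k _ Gex _ f.
- by move=> l kl; apply: G_bounded; apply: leq_ltn_trans kl; apply: leq_addl.
- by move=> i [//|l] _ _; apply: G_acyclic.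
- by move=> y; have [v _ vE] := fd y; exists v.
have [|h' h'E] := Ch h.
  move=> c; have [y <-] := res_aug_onto P c; have [r [v _ vE]] := fw y.
  have -> : h (res_aug P y) = D k (v - g y) + r *: w.
    by rewrite linearB vE fE addrAC subrK addrK.
  by apply: (submodD sZ) => //; apply: submodZ.
by apply: ny0; exists (h' (res_aug P y0) + g y0) => //; rewrite fE h'E linearD.
Qed.

Hypothesis Hom_exact : forall k (h : {linear C -> G k.+1}), (forall c, D k (h c) = 0) ->
  exists h' : {linear C -> G k.+2}, forall c, h c = D k.+1 (h' c).

(** Descending induction on the degree, starting where the complex is zero. *)
Lemma exact_of_hom k : exact_at k.
Proof.
have [d] := ubnP (n - k); elim: d k => // d IH k kd.
have [nk|kn] := leqP n k.
  move=> v _; exists 0; rewrite linear0; symmetry.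
  by apply: (@G_bounded k.+1).
move=> v Dv; apply: (@hom_detects_image k.+1 [set v | D k v = 0]) => //.
- split; first exact: linear0.
  by move=> a x y /= xx yy; rewrite linearP xx yy scaler0 addr0.
- by move=> u; apply: DK.
- by move=> l kl; apply: IH; rewrite ltnS in kd; apply: leq_trans kd; apply: ltn_sub2l.
- exact: Hom_exact.
Qed.

Lemma surjective_of_hom :
  (forall h : {linear C -> G 0}, exists h' : {linear C -> G 1}, forall c, h c = D 0 (h' c)) ->
  forall v, exists u, D 0 u = v.
Proof.
move=> Ch v; apply: (@hom_detects_image 0 setT) => //.
by move=> l _; apply: exact_of_hom.
Qed.

End Detection.
End Complexes.
End Resolutions.

(** * Powers of a module and matrices acting on them *)

Section Powers.
Variables (R : comNzRingType).
Implicit Types (C W : lmodType R).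

Section MatrixAction.
Variables (C : lmodType R) (p q : nat) (A : 'M[R]_(p, q)).

Definition mxact_fun (v : pow C q) : pow C p := [ffun i => \sum_j A i j *: v j].

Fact mxact_is_linear : linear mxact_fun.
Proof.
move=> a u v; apply/ffunP=> i; rewrite !ffunE scaler_sumr -big_split /=.
by apply: eq_bigr => j _; rewrite !ffunE scalerDr !scalerA mulrC.
Qed.

(** Obtained by choice rather than packed from the function, so that it does not
unfold under simplification. *)
Definition mxact : {linear pow C q -> pow C p} :=
  sval (cid (exists_linear mxact_is_linear)).

Lemma mxactE v i : mxact v i = \sum_j A i j *: v j.
Proof. by rewrite /mxact; case: cid => f /= ->; rewrite ffunE. Qed.

End MatrixAction.

Definition tens C b (r : vec R b) (c : C) : pow C b := [ffun j => r j *: c].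

Lemma mxact_tens C p q (A : 'M[R]_(p, q)) (r : vec R q) (c : C) :
  mxact C A (tens r c) = tens (mxact (reg R) A r) c.
Proof.
apply/ffunP=> i; rewrite mxactE ffunE mxactE scaler_suml; apply: eq_bigr => j _.
by rewrite ffunE scalerA.
Qed.

Definition pow_coord C b (j : 'I_b) (v : pow C b) : C := v j.

Fact pow_coord_is_linear C b (j : 'I_b) : linear (@pow_coord C b j).
Proof. by move=> a u v; rewrite /pow_coord !ffunE. Qed.

Definition proj_pow C b (j : 'I_b) : {linear pow C b -> C} :=
  HB.pack (@pow_coord C b j)
    (GRing.isLinear.Build R _ _ *:%R (@pow_coord C b j) (pow_coord_is_linear j)).

Lemma pair_pow C b W (f : 'I_b -> {linear W -> C}) :
  exists g : {linear W -> pow C b}, forall w j, g w j = f j w.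
Proof.
have [|g gE] := @exists_linear R W (pow C b) (fun w => [ffun j => f j w]).
  by move=> a u v; apply/ffunP=> j; rewrite !ffunE linearP.
by exists g => w j; rewrite gE ffunE.
Qed.

Lemma copair_pow C b W (f : 'I_b -> {linear C -> W}) :
  exists g : {linear pow C b -> W}, forall v, g v = \sum_j f j (v j).
Proof.
apply: exists_linear => a u v; rewrite scaler_sumr -big_split /=.
by apply: eq_bigr => j _; rewrite !ffunE linearP.
Qed.

Lemma combination b W (e : 'I_b -> W) :
  exists g : {linear vec R b -> W}, forall v, g v = \sum_j v j *: e j.
Proof.
apply: exists_linear => a u v; rewrite scaler_sumr -big_split /=.
by apply: eq_bigr => j _; rewrite !ffunE scalerDl scalerA.
Qed.

Definition unit_vec b (j : 'I_b) : vec R b := [ffun i => (i == j)%:R].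

Lemma sum_tens C b (v : pow C b) : v = \sum_j tens (unit_vec j) (v j).
Proof.
apply/ffunP=> i; rewrite sum_ffunE (bigD1 i) //= big1 => [|j ji]; last first.
  by rewrite !ffunE eq_sym (negPf ji) scale0r.
by rewrite !ffunE eqxx addr0 scale1r.
Qed.

Lemma tens_linear C b (r : vec R b) :
  exists g : {linear C -> pow C b}, forall c, g c = tens r c.
Proof.
apply: exists_linear => a u v; apply/ffunP=> j; rewrite !ffunE.
by rewrite scalerDr !scalerA mulrC.
Qed.

Lemma pow_fg C b : finitely_generated C -> finitely_generated (pow C b).
Proof.
move=> [us usE].
pose s := flatten [seq [seq tens (unit_vec j) u | u <- us] | j : 'I_b].
exists s; apply/seteqP; split=> // v _.
have sS := span_is_submodule [set` s].
rewrite (sum_tens v); apply: (submod_sum sS) => j _.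
have [g gE] := tens_linear C (unit_vec j).
rewrite -gE; have : span [set` us] (v j) by rewrite usE.
move=> /(@span_image _ _ _ g); apply: span_mono => _ [u uus <-].
rewrite /= gE; apply/flattenP; exists [seq tens (unit_vec j) u | u <- us].
  by apply/mapP; exists j => //; rewrite mem_enum.
exact: map_f.
Qed.

Lemma sum_unit_vec b (v : vec R b) : v = \sum_j v j *: unit_vec j.
Proof.
apply/ffunP=> i; rewrite sum_ffunE (bigD1 i) //= big1 => [|j ji]; last first.
  by rewrite !ffunE eq_sym (negPf ji) [_ *: _]mulr0.
by rewrite !ffunE eqxx addr0 [_ *: _]mulr1.
Qed.

Lemma linear_vec b W (f : {linear vec R b -> W}) v : f v = \sum_j v j *: f (unit_vec j).
Proof. by rewrite {1}(sum_unit_vec v) linear_sum; apply: eq_bigr => j _; rewrite linearZ. Qed.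

Lemma vec_projective b : is_projective (vec R b).
Proof.
move=> U V g h gs.
have [e eE] := choice (fun j => surj_ex gs (h (unit_vec j))).
have [f fE] := combination e.
exists f => v; rewrite fE linear_sum linear_vec; apply: eq_bigr => j _.
by rewrite linearZ eE.
Qed.

Lemma Ext0_lift_pow (M C : lmodType R) (P : proj_resolution M) i b
    (f : {linear res_obj P i.+1 -> pow C b}) :
  Ext_eq0 i.+1 M C -> (forall y, f (res_diff P i.+1 y) = 0) ->
  exists g : {linear res_obj P i -> pow C b}, forall y, f y = g (res_diff P i y).
Proof.
move=> E fd.
have ex j : exists g : {linear res_obj P i -> C}, forall y, f y j = g (res_diff P i y).
  apply: (Ext0_lift (f := proj_pow C j \o f)) => // y.
  by rewrite /= fd /pow_coord ffunE.
have [g gE] := choice ex; have [h hE] := pair_pow g.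
by exists h => y; apply/ffunP=> j; rewrite gE hE.
Qed.

End Powers.

(** Dependent choice for composable matrices. Both sizes belong to the state, so
that consecutive sizes agree by conversion. *)
Lemma matrix_chain (R : Type) (Q : forall p q, 'M[R]_(p, q) -> Prop)
    (E : forall p q r, 'M[R]_(p, q) -> 'M[R]_(q, r) -> Prop)
    (Z : forall p q, 'M[R]_(p, q) -> Prop) :
  (forall p q (A : 'M[R]_(p, q)), Q p q A ->
     exists r (B : 'M[R]_(q, r)), Q q r B /\ E p q r A B) ->
  forall p q (A0 : 'M[R]_(p, q)), Q p q A0 -> Z p q A0 ->
  exists (rk : nat -> nat) (A : forall i, 'M[R]_(rk i, rk i.+1)),
    Z _ _ (A 0) /\ forall i, Q _ _ (A i) /\ E _ _ _ (A i) (A i.+1).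
Proof.
move=> step p q A0 QA0 ZA0.
pose st := {p : nat & {q : nat & {A : 'M[R]_(p, q) | Q p q A}}}.
pose mxof (s : st) := sval (projT2 (projT2 s)).
have nextP (s : st) : exists r, exists B : {B : 'M[R]_(projT1 (projT2 s), r) | Q _ _ B},
    E _ _ _ (mxof s) (sval B).
  have [r [B [QB EB]]] := step _ _ _ (svalP (projT2 (projT2 s))).
  by exists r, (exist _ B QB).
pose next (s : st) : st := existT _ (projT1 (projT2 s))
  (existT _ (projT1 (cid (nextP s))) (projT1 (cid (projT2 (cid (nextP s)))))).
have nextE s : E _ _ _ (mxof s) (mxof (next s)).
  exact: (projT2 (cid (projT2 (cid (nextP s))))).
pose st0 : st := existT _ p (existT _ q (exist _ A0 QA0)).
pose sq i := iter i next st0.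
exists (fun i => projT1 (sq i)), (fun i => mxof (sq i)); split=> // i.
by split; [exact: (svalP (projT2 (projT2 (sq i)))) | exact: nextE].
Qed.

(** * Minimal free resolutions *)

Section MinimalResolutions.
Variables (R : comNzRingType) (m : set R).
Hypothesis noeth : noetherian R.
Hypothesis mI : is_ideal m.
Hypothesis unitm : forall a, ~ m a -> exists b, b * a = 1.

Lemma redundant_generator (W : lmodType R) b (e : 'I_b -> W) (a : 'I_b -> R) j :
  \sum_i a i *: e i = 0 -> ~ m (a j) ->
  exists s : seq W, [/\ size s = b.-1, {in s, forall x, exists i, x = e i} &
    forall c : 'I_b -> R, span [set` s] (\sum_i c i *: e i)].
Proof.
move=> ae0 /unitm[u ua]; exists [seq e i | i in predC1 j]; split.
- by rewrite size_image cardC1 card_ord.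
- by move=> x /mapP[i _ ->]; exists i.
have sS := span_is_submodule [set` [seq e i | i in predC1 j]].
have Si i : i != j -> span [set` [seq e i | i in predC1 j]] (e i).
  by move=> ij; apply: span_sub; rewrite /= fintype.image_f // inE.
move=> c; apply: (submod_sum sS) => i _; apply: (submodZ _ sS).
have [->|/Si//] := eqVneq i j.
have -> : e j = - u *: \sum_(i | i != j) a i *: e i.
  move: ae0; rewrite (bigD1 j) //= => /eqP; rewrite addr_eq0 => /eqP E.
  by rewrite scaleNr -scalerN -E scalerA ua scale1r.
apply: (submodZ _ sS); apply: (submod_sum sS) => k kj.
by apply: (submodZ _ sS); apply: Si.
Qed.

(** A coefficient outside m in a relation is a unit, which makes a generator
redundant; a generating list of least size has no such relation. *)
Lemma minimal_generators (W : lmodType R) (Z : set W) : fg_set Z ->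
  exists b (e : 'I_b -> W), (forall x, Z x <-> exists a : vec R b, x = \sum_i a i *: e i) /\
    forall a : vec R b, \sum_i a i *: e i = 0 -> forall j, m (a j).
Proof.
move=> [s sE]; have [n] := ubnP (size s); elim: n s sE => // n IH s sE sn.
pose e (i : 'I_(size s)) := s`_i.
have eE x : Z x <-> exists a : vec R (size s), x = \sum_i a i *: e i.
  rewrite -sE span_seqP; split=> [[a ->]|[a ->]].
    by exists [ffun i : 'I__ => a i]; apply: eq_bigr => i _; rewrite ffunE.
  exists (fun k : nat => if insub k is Some i then a i else 0).
  by apply: eq_bigr => i _; rewrite valK.
have [min|/existsNP[a /not_implyP[ae0 /existsNP[j aj]]]] :=
  pselect (forall a : vec R (size s), \sum_i a i *: e i = 0 -> forall j, m (a j)).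
  by exists (size s), e.
have [s' [s's s'Z s'e]] := redundant_generator ae0 aj.
have sZ : is_submodule Z by rewrite -sE; apply: span_is_submodule.
apply: (IH s').
  apply/seteqP; split.
    apply: span_min => // x /s'Z[i ->]; rewrite -sE; apply: span_sub.
    exact: mem_nth.
  by move=> x /eE[c ->]; apply: s'e.
by rewrite s's -ltnS; apply: leq_trans sn; rewrite ltnS prednK // (leq_ltn_trans _ (ltn_ord j)).
Qed.

Definition matrix_in p q (A : 'M[R]_(p, q)) := forall i j, m (A i j).

Lemma mxact_ideal_smul p q (A : 'M[R]_(p, q)) : matrix_in A ->
  forall (C : lmodType R) (v : pow C q) i, ideal_smul m setT (mxact C A v i).
Proof.
move=> mA C v i; rewrite mxactE; apply: (submod_sum (ideal_smul_submod _ _)) => j _.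
exact: ideal_smul_scale.
Qed.

Lemma ideal_smul_regular (a : R) : ideal_smul m (setT : set (reg R)) a -> m a.
Proof.
apply: span_min => // _ [b [c [mb _ ->]]].
by rewrite [_ *: _]mulrC; apply: (submodZ _ mI).
Qed.

Lemma mxact_delta p q (A : 'M[R]_(p, q)) i j : mxact (reg R) A (unit_vec R j) i = A i j.
Proof.
rewrite mxactE (bigD1 j) //= big1 => [|k kj]; last first.
  by rewrite !ffunE (negPf kj) [_ *: _]mulr0.
by rewrite ffunE eqxx addr0 [_ *: _]mulr1.
Qed.

(** The columns of the next matrix of the resolution are relations of this one,
so this is what puts the entries of the next matrix in m. *)
Definition minimal_relations p q (A : 'M[R]_(p, q)) :=
  forall u, mxact (reg R) A u = 0 -> forall j, m (u j).

Lemma kernel_presentation q (W : lmodType R) (f : {linear vec R q -> W}) :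
  (forall v, f v = 0 -> forall j, m (v j)) ->
  exists r (B : 'M[R]_(q, r)), [/\ matrix_in B,
    (forall v, f v = 0 <-> exists u, v = mxact (reg R) B u) &
    minimal_relations B].
Proof.
move=> fm.
have [r [e [eE emin]]] : exists r (e : 'I_r -> vec R q),
    (forall x, f x = 0 <-> exists a : vec R r, x = \sum_i a i *: e i) /\
    forall a : vec R r, \sum_i a i *: e i = 0 -> forall j, m (a j).
  apply: (@minimal_generators _ [set v | f v = 0]).
  apply: (submod_fg noeth (pow_fg q (fgR R))).
  exact: (preim_submod f (submod_set0 W)).
pose B := \matrix_(i < q, j < r) (e j i : R).
have BE u : mxact (reg R) B u = \sum_i u i *: e i.
  apply/ffunP=> i; rewrite mxactE sum_ffunE; apply: eq_bigr => j _.
  by rewrite mxE !ffunE [LHS]mulrC.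
exists r, B; split.
- move=> i j; rewrite mxE; apply: fm; apply/eE; exists (unit_vec R j).
  rewrite -BE; apply/ffunP=> k; rewrite mxact_delta mxE //.
- by move=> v; rewrite eE; split=> -[u ->]; exists u; rewrite BE.
- by move=> u; rewrite BE; apply: emin.
Qed.

Record minres (X : lmodType R) := MinRes {
  mr_rank : nat -> nat;
  mr_mx : forall i, 'M[R]_(mr_rank i, mr_rank i.+1);
  mr_aug : {linear vec R (mr_rank 0) -> X};
  mr_surj : forall x, exists v, mr_aug v = x;
  mr_aug_exact : forall v, mr_aug v = 0 <-> exists u, v = mxact (reg R) (mr_mx 0) u;
  mr_exact : forall i v, mxact (reg R) (mr_mx i) v = 0 <->
    exists u, v = mxact (reg R) (mr_mx i.+1) u;
  mr_in : forall i, matrix_in (mr_mx i) }.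

Lemma minres_exists (X : lmodType R) : finitely_generated X -> inhabited (minres X).
Proof.
move=> fgX.
have [b0 [e [eE emin]]] := @minimal_generators X setT fgX.
have [eps epsE] := combination e.
have epsm v : eps v = 0 -> forall j, m (v j) by rewrite epsE; apply: emin.
have [b1 [A0 [A0m A0E A0min]]] := kernel_presentation epsm.
pose Z p q (A : 'M[R]_(p, q)) := exists f : {linear vec R p -> X},
  (forall x, exists v, f v = x) /\
  forall v, f v = 0 <-> exists u, v = mxact (reg R) A u.
have [|||rk [A [[f [fs fE]] QE]]] := @matrix_chain R
  (fun p q A => matrix_in A /\ minimal_relations A)
  (fun p q r A B => forall v, mxact (reg R) A v = 0 <->
     exists u, v = mxact (reg R) B u) Z _ _ _ A0.
- move=> p q B [_ Bmin]; have [r [B' [Bm' BE' Bmin']]] := kernel_presentation Bmin.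
  by exists r, B'.
- by [].
- exists eps; split; last exact: A0E.
  by move=> x; have [a aE] := (eE x).1 I; exists a; rewrite epsE.
by constructor; apply: (@MinRes X rk A f) => // i; case: (QE i) => -[].
Qed.

End MinimalResolutions.

(** * Finite projective dimension *)

Section ProjectiveDimension.
Variables (R : comNzRingType) (m : set R).
Hypothesis mI : is_ideal m.
Hypothesis m1 : ~ m 1.

Definition vec_in (I : set R) b (v : vec R b) := forall j, I (v j).

Lemma vec_in_linear (I : set (reg R)) p q (f : {linear vec R p -> vec R q}) v :
  is_submodule I -> vec_in I v -> vec_in I (f v).
Proof.
move=> sI Iv i; rewrite linear_vec sum_ffunE; apply: (submod_sum sI) => j _.
by rewrite ffunE [_ *: _]mulrC; exact: (submodZ _ sI (Iv j)).
Qed.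

Lemma vec_in_submod (I : set (reg R)) b : is_submodule I -> is_submodule (@vec_in I b).
Proof.
move=> sI; split=> [j|a u v Iu Iv j]; rewrite !ffunE; first exact: submod0.
by apply: (submodD sI) => //; exact: (submodZ _ sI (Iu j)).
Qed.

Lemma vec_in_full I b : is_ideal I -> ~ I 1 -> (forall v : vec R b, vec_in I v) -> b = 0%N.
Proof.
case: b => // b idI nI H; case: nI.
by have := H (unit_vec R ord0) ord0; rewrite ffunE eqxx.
Qed.

Section Termination.
Variables (X : lmodType R) (F : minres m X).
Notation rk := (mr_rank F).
Notation dF i := (mxact (reg R) (mr_mx F i)).

Lemma minres_dd i v : dF i (dF i.+1 v) = 0.
Proof. by apply/mr_exact; exists v. Qed.

Lemma minres_in i (v : vec R (rk i.+1)) : vec_in m (dF i v).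
Proof. by move=> j; exact: (ideal_smul_regular mI (mxact_ideal_smul (@mr_in _ _ _ F i) v j)). Qed.

(** The identity of a minimal resolution is homotopic to any composite
F -> P -> F of comparison maps; U is the part of the homotopy that comes from
the previous degree, and by minimality its values lie in mF. *)
Lemma minres_homotopy (P : proj_resolution X) i :
  exists (al : {linear vec R (rk i) -> res_obj P i})
    (be : {linear res_obj P i -> vec R (rk i)})
    (S : {linear vec R (rk i) -> vec R (rk i.+1)})
    (U : {linear vec R (rk i) -> vec R (rk i)}),
  [/\ forall v, exists y, al (dF i v) = res_diff P i y,
      forall y, exists v, be (res_diff P i y) = dF i v,
      forall v, U (dF i v) = 0, forall v, vec_in m (U v) &
      forall v, v = be (al v) + dF i (S v) + U v].
Proof.
elim: i => [|i [al [be [S [U [ald bed Ud Um id_]]]]]].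
  have [|al alE] := proj_lift (g := res_aug P) (h := mr_aug F) (@vec_projective R (rk 0)).
    by move=> v; apply: res_aug_onto.
  have [|be beE] := proj_lift (g := mr_aug F) (h := res_aug P) (@res_proj _ _ P 0).
    by move=> v; apply: mr_surj.
  have [|S SE] := proj_lift (g := dF 0) (h := idfun - (be \o al : {linear _ -> _}))
    (@vec_projective R (rk 0)).
    move=> v.
    have /mr_aug_exact[u uE] : mr_aug F (v - be (al v)) = 0.
      by rewrite linearB beE alE subrr.
    by exists u; rewrite -uE.
  exists al, be, S, \0; split.
  - move=> v; have /res_aug_ker[y <-] : res_aug P (al (dF 0 v)) = 0.
      by rewrite alE; apply/mr_aug_exact; exists v.
    by exists y.
  - move=> y; apply/mr_aug_exact; by rewrite beE res_augK.
  - by [].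
  - by move=> v j; rewrite ffunE; apply: (submod0 mI).
  - by move=> v; rewrite SE sub_homE addr0 /= addrC subrK.
have [|al' al'E] := proj_lift (g := res_diff P i) (h := al \o dF i) (@vec_projective R (rk i.+1)).
  by move=> v; have [y yE] := ald v; exists y.
have [|be' be'E] := proj_lift (g := dF i) (h := be \o res_diff P i) (@res_proj _ _ P i.+1).
  by move=> y; have [v vE] := bed y; exists v.
have [|S' S'E] := proj_lift (g := dF i.+1)
  (h := idfun - (be' \o al' : {linear _ -> _}) - (S \o dF i : {linear _ -> _}))
  (@vec_projective R (rk i.+1)).
  move=> v.
  have /mr_exact[u uE] : dF i (v - be' (al' v) - S (dF i v)) = 0.
    rewrite !linearB [dF i (be' _)]be'E /= al'E /=.
    rewrite {1}(id_ (dF i v)) Ud addr0 addrAC.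
    by rewrite addrK subrr.
  by exists u; rewrite -uE.
exists al', be', S', (S \o dF i); split.
- move=> v; have /res_diff_ker[y <-] : res_diff P i (al' (dF i.+1 v)) = 0.
    by rewrite al'E /= minres_dd linear0.
  by exists y.
- by move=> y; apply/mr_exact; rewrite be'E /= res_diffK linear0.
- by move=> v; rewrite /= minres_dd linear0.
- by move=> v; apply: (vec_in_linear S mI); apply: minres_in.
- by move=> v; rewrite S'E !sub_homE /= -addrA subrK addrC subrK.
Qed.

(** In a degree where P vanishes, v = dF (S v) + U v lies in mF for all v. *)
Lemma minres_finite : finite_pd X -> exists n, forall i, (n < i)%N -> rk i = 0%N.
Proof.
move=> [P [n Pz]]; exists n => i ni; apply: (vec_in_full mI m1) => v.
have [al [be [S [U [_ _ _ Um id_]]]]] := minres_homotopy P i.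
rewrite (id_ v) [al v](Pz i ni) linear0 add0r.
apply: (submodD (vec_in_submod _ mI)) => //; exact: minres_in.
Qed.

(** Exactness of F/IF in degree i + 1. *)
Definition exact_mod (I : set R) i :=
  forall v, vec_in I (dF i v) -> exists u, vec_in I (v - dF i.+1 u).

(** The long exact homology sequence of 0 -> F/IF -> F/IF -> F/(I + xR)F -> 0:
each regular element costs one degree of exactness. *)
Lemma exact_mod_add_mul (I : set (reg R)) x i : is_submodule I -> regmod I x ->
  exact_mod I i -> exact_mod I i.+1 -> exact_mod (add_mul I x) i.+1.
Proof.
move=> sI rI E0 E1 v Iv.
have sV b := vec_in_submod b sI.
have [y [w [Iy dv]]] : exists y w, vec_in I y /\ dF i.+1 v = y + x *: w.
  have ex j : exists yw : (reg R * reg R)%type, I yw.1 /\ dF i.+1 v j = yw.1 + x *: yw.2.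
    by have [a [c [Ia cE]]] := Iv j; exists (a, c).
  have [f fE] := choice ex.
  exists [ffun j => (f j).1], [ffun j => (f j).2]; split.
    by move=> j; rewrite ffunE; case: (fE j).
  by apply/ffunP=> j; case: (fE j) => _ ->; rewrite !ffunE.
have [|u uE] := E0 w.
  move=> j; apply: rI.
  have E : x *: dF i w = - dF i y.
    by apply/eqP; rewrite -addr_eq0 addrC -linearZ -linearD -dv minres_dd.
  have := submodN (sV _) (vec_in_linear (dF i) sI Iy).
  by rewrite -E => /(_ j); rewrite ffunE.
have [|z zE] := E1 (v - x *: u).
  rewrite linearB linearZ dv /= -addrA -scalerBr.
  by apply: (submodD (sV _)) => //; apply: (submodZ _ (sV _)).
exists z => j; exists ((v - x *: u - dF i.+2 z) j), (u j); split; first exact: zE.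
by rewrite !ffunE addrAC subrK.
Qed.

Lemma exact_mod_add_muls xs i : regs [set (0 : reg R)] xs -> (size xs <= i)%N ->
  exact_mod (add_muls [set (0 : reg R)] xs) i.
Proof.
suff gen k (I : set (reg R)) : is_submodule I -> (forall l, (k <= l)%N -> exact_mod I l) ->
    regs I xs -> (k + size xs <= i)%N -> exact_mod (add_muls I xs) i.
  apply: (gen 0%N) => [|l _ v v0]; first exact: submod_set0.
  have /mr_exact[u ->] : dF l v = 0.
    by apply/ffunP=> j; rewrite v0 ffunE.
  by exists u => j; rewrite subrr ffunE.
elim: xs k I => [|x xs IH] k I sI E /=; first by rewrite addn0 => _; apply: E.
move=> [rI rxs]; rewrite addnS -addSn; apply: IH => //; first exact: add_mul_submod.
by move=> [//|l] kl; apply: exact_mod_add_mul => //; apply: E => //; apply: leqW.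
Qed.

(** The Auslander-Buchsbaum bound. Beyond degree depth R, the last nonzero
differential stays injective modulo xs; but its entries lie in m, so it vanishes
on s F modulo xs, where s is a socle element of R/(xs). *)
Lemma minres_depth_bound xs : regs [set (0 : reg R)] xs ->
  has_socle m (add_muls [set (0 : reg R)] xs) -> finite_pd X ->
  forall i, (size xs < i)%N -> rk i = 0%N.
Proof.
move=> rxs [s ns ms] /minres_finite[n nz] i xi.
have [d] := ubnP (n.+1 - i); elim: d i xi => // d IH i xi di.
have [/nz//|in_] := ltnP n i.
have rz : rk i.+1 = 0%N.
  apply: IH; first exact: ltnW.
  rewrite ltnS in di; apply: leq_trans di; apply: ltn_sub2l => //.
have sA := add_muls_submod xs (submod_set0 (reg R)).
case: i xi in_ rz di => // i xi in_ rz di.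
case E : (rk i.+1) => [//|b]; case: ns.
have j0 : 'I_(rk i.+1) by rewrite E; exact: ord0.
have [|u uE] := exact_mod_add_muls rxs xi (v := s *: unit_vec R j0).
  move=> j; rewrite linearZ ffunE [_ *: _]mulrC.
  exact/ms/minres_in.
have := uE j0; rewrite !ffunE mxactE eqxx big1 ?subr0 ?[_ *: _]mulr1 // => k _.
by exfalso; have := ltn_ord k; move: (nat_of_ord k); rewrite rz.
Qed.

End Termination.
End ProjectiveDimension.

(** * Hom modules and tensor products *)

Section Generation.
Variables (R : comNzRingType).

Lemma fg_injective (U V : lmodType R) (f : {linear U -> V}) : noetherian R ->
  injective f -> finitely_generated V -> finitely_generated U.
Proof.
move=> noeth finj fgV; have [s sE] := submod_fg noeth fgV (range_submod f).
have [s' s'E] : exists s' : seq U, s = [seq f u | u <- s'].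
  have : {in s, forall v, range f v} by move=> v vs; rewrite -sE; apply: span_sub.
  elim: s {sE} => [|v s IH] sr; first by exists [::].
  have [|s' ->] := IH; first by move=> w ws; apply: sr; rewrite inE ws orbT.
  by have [u _ <-] := sr v (mem_head _ _); exists (u :: s').
exists s'; apply/seteqP; split=> // u _.
have : span [set` s] (f u) by rewrite sE; exists u.
suff sub v : span [set` s] v -> exists2 u', span [set` s'] u' & f u' = v.
  by move=> /sub[u' su' /finj <-].
have sS := span_is_submodule [set` s'].
move: v; refine (span_ind _ _); first exact: (image_submod f sS).
move=> v /=; rewrite s'E => /mapP[u' u's ->]; exists u' => //.
exact: span_sub.
Qed.

Lemma hom_fg (C X : lmodType R) : noetherian R -> finitely_generated C ->
  finitely_generated X -> finitely_generated {linear C -> X}.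
Proof.
move=> noeth [us usE] fgX.
have [|ev evE] := @exists_linear R {linear C -> X} (pow X (size us))
  (fun h => [ffun i : 'I_(size us) => h us`_i]).
  by move=> a f g; apply/ffunP=> i; rewrite !ffunE.
apply: (fg_injective (f := ev)) (pow_fg _ fgX) => // f g fg.
apply: linear_eq => c; have : span [set` us] c by rewrite usE.
move=> /span_seqP[a ->]; rewrite !linear_sum; apply: eq_bigr => i _.
rewrite !linearZ; congr (_ *: _).
by have /ffunP/(_ i) := fg; rewrite !evE !ffunE.
Qed.

End Generation.

Section Tensor.
Variables (R : comNzRingType) (M N : lmodType R).

Definition pure_tensor (x : M) (y : N) : tensor M N :=
  quotmod_pi (@tensor_rel R M N) (tensor_gen x y).

Lemma pure_tensor_linear (y : N) :
  exists h : {linear M -> tensor M N}, forall x, h x = pure_tensor x y.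
Proof.
have [p [pE ps p0]] := quot_lin (@tensor_rel R M N).
have pr w : tensor_rel w -> p w = 0 by move=> /span_sub/p0.
apply: (@exists_linear R M (tensor M N)) => a u v; rewrite /pure_tensor -!pE.
have := pr _ (tensor_relDl (a *: u) v y); rewrite !linearB /=.
move=> /eqP; rewrite -addrA -opprD subr_eq0 => /eqP ->.
have := pr _ (tensor_relZl a u y); rewrite linearB linearZ /=.
by move=> /eqP; rewrite subr_eq0 => /eqP ->.
Qed.

Lemma pure_tensor_linearr (x : M) :
  exists h : {linear N -> tensor M N}, forall y, h y = pure_tensor x y.
Proof.
have [p [pE ps p0]] := quot_lin (@tensor_rel R M N).
have pr w : tensor_rel w -> p w = 0 by move=> /span_sub/p0.
apply: (@exists_linear R N (tensor M N)) => a u v; rewrite /pure_tensor -!pE.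
have := pr _ (tensor_relDr x (a *: u) v); rewrite !linearB /=.
move=> /eqP; rewrite -addrA -opprD subr_eq0 => /eqP ->.
have := pr _ (tensor_relZr a x u); rewrite linearB linearZ /=.
by move=> /eqP; rewrite subr_eq0 => /eqP ->.
Qed.

Lemma tensor_span z : span [set w : tensor M N | exists x y, w = pure_tensor x y] z.
Proof.
have [p [pE ps p0]] := quot_lin (@tensor_rel R M N).
set S := [set w | _]; have sS := span_is_submodule S.
have [w <-] := ps z; rewrite -(freeg_sumE w) linear_sum.
apply: (submod_sum sS) => -[x y] _.
have -> : << coeff (x, y) w *g (x, y) >> =
    coeff (x, y) w *: (<< (x, y) >> : {freeg (M * N)%type / R}).
  by apply/eqP/freeg_eqP => k'; rewrite coeffZ !coeffU mul1r.
rewrite linearZ; apply: (submodZ _ sS); apply: span_sub; exists x, y.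
by rewrite pE.
Qed.

Lemma tensor_fg : finitely_generated M -> finitely_generated N ->
  finitely_generated (tensor M N).
Proof.
move=> [us usE] [vs vsE].
pose s := [seq pure_tensor u v | u <- us, v <- vs].
exists s; apply/seteqP; split=> // z _; have sS := span_is_submodule [set` s].
have := tensor_span z; apply: span_min => // _ [x [y ->]].
have [hy hyE] := pure_tensor_linear y; rewrite -hyE.
have : span [set` us] x by rewrite usE.
move: x; refine (span_ind _ _); first exact: (preim_submod hy sS).
move=> u uus; rewrite hyE; have [hu huE] := pure_tensor_linearr u; rewrite -huE.
have : span [set` vs] y by rewrite vsE.
move: y {hy hyE}; refine (span_ind _ _); first exact: (preim_submod hu sS).
move=> v vvs; rewrite huE; apply: span_sub.
exact: (allpairs_f pure_tensor uus vvs).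
Qed.

Lemma tensor_universal (V : lmodType R) (phi : M -> N -> V) :
  (forall y, linear (phi^~ y)) -> (forall x, linear (phi x)) ->
  is_zero_module (tensor M N) -> forall x y, phi x y = 0.
Proof.
move=> ll lr T0 x y.
have [F FE] : exists F : {linear {freeg (M * N)%type / R} -> V},
    forall u v, F (tensor_gen u v) = phi u v.
  exists (free_map (fun k : M * N => phi k.1 k.2)) => u v.
  exact: (free_mapE _ (u, v)).
have : span (@tensor_rel R M N) (tensor_gen x y).
  have [p [pE ps p0]] := quot_lin (@tensor_rel R M N).
  by apply/p0; apply: T0.
rewrite -FE; apply: (span_min (preim_submod F (submod_set0 V))) => _ [].
- move=> u u' v; rewrite /= !linearB !FE.
  by have := ll v 1 u u'; rewrite !scale1r => ->; rewrite addrAC addrK subrr.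
- move=> u v v'; rewrite /= !linearB !FE.
  by have := lr u 1 v v'; rewrite !scale1r => ->; rewrite addrAC addrK subrr.
- move=> a u v; rewrite /= linearB linearZ !FE.
  have l0 : phi 0 v = 0 by have := ll v (- 1) 0 0; rewrite scaler0 addr0 scaleN1r addNr.
  by have := ll v a u 0; rewrite l0 !addr0 => ->; rewrite subrr.
- move=> a u v; rewrite /= linearB linearZ !FE.
  have l0 : phi u 0 = 0 by have := lr u (- 1) 0 0; rewrite scaler0 addr0 scaleN1r addNr.
  by have := lr u a v 0; rewrite l0 !addr0 => ->; rewrite subrr.
Qed.

Variable m : set R.
Hypothesis mI : is_ideal m.
Hypothesis m1 : ~ m 1.
Hypothesis unitm : forall a, ~ m a -> exists b, b * a = 1.

(** For M and N nonzero, a coordinate of N with respect to minimal generators is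
well defined modulo m and gives a nonzero bilinear map to M/mM <> 0. *)
Lemma tensor_eq0 : finitely_generated M -> finitely_generated N ->
  is_zero_module (tensor M N) -> is_zero_module M \/ is_zero_module N.
Proof.
move=> fgM fgN T0; have [M0|nM0] := pselect (is_zero_module M); [by left|right].
have [b [e [eE emin]]] := @minimal_generators _ _ unitm N setT fgN.
have [a aE] := choice (fun x => (eE x).1 I).
have [x nx] : exists x : M, ~ ideal_smul m setT x.
  apply: contrapT => nx; apply: nM0 => x.
  have /seteqP[_ /(_ x I)//] : [set 0] = [set: M].
  refine (nakayamaT mI m1 unitm (submod_set0 M) fgM _) => u; apply: sumsetr.
    exact: submod_set0.
  by apply: contrapT => nu; apply: nx; exists u.
have sm := ideal_smul_submod m (setT : set M).
have [p [_ ps p0]] := quot_lin (ideal_smul m (setT : set M)); rewrite span_id // in p0.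
case: b e eE emin a aE => [|b] e eE emin a aE; first by move=> y; rewrite (aE y) big_ord0.
pose phi (u : M) (v : N) := p (a v ord0 *: u).
have lr u : linear (phi u).
  move=> c v v'; rewrite /phi -linearZ -linearD /=; apply/eqP.
  rewrite -subr_eq0 -linearB /=; apply/eqP/p0.
  rewrite scalerA -scalerDl -scalerBl; apply: ideal_smul_scale => //.
  have := emin (a (c *: v + v') - (c *: a v + a v')) _ ord0.
  rewrite !ffunE; apply.
  under eq_bigr do rewrite !ffunE scalerBl scalerDl -[(c *: a v _) *: _]scalerA.
  by rewrite sumrB -aE big_split /= -scaler_sumr -!aE subrr.
have ll v : linear (phi^~ v).
  by move=> c u u'; rewrite /phi scalerDr scalerA mulrC -scalerA linearP.
have /p0 h := tensor_universal ll lr T0 x (e ord0).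
case: nx; have ma : m (1 - a (e ord0) ord0).
  have := emin (unit_vec R ord0 - a (e ord0)) _ ord0.
  rewrite !ffunE eqxx; apply.
  under eq_bigr do rewrite !ffunE scalerBl.
  rewrite sumrB -aE (bigD1 ord0) //= ?eqxx scale1r big1 ?addr0 ?subrr // => j j0.
  by rewrite (negPf j0) scale0r.
have := ideal_smul_scale ma (I : (setT : set M) x); rewrite scalerBl scale1r.
by move=> /(submodD sm h); rewrite addrC subrK.
Qed.

End Tensor.

(** * Minimal syzygies *)

Section Syzygy.
Variables (R : comNzRingType) (m : set R).
Hypothesis unitm : forall a, ~ m a -> exists b, b * a = 1.

Variables (M L : lmodType R) (n : nat).
Variables (iota : {linear M -> 'rV[R]_n}) (p : {linear 'rV[R]_n -> L}).
Hypothesis iota_inj : injective iota.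
Hypothesis iota_range : forall v, p v = 0 <-> exists w, iota w = v.
Hypothesis p_surj : forall l, exists v, p v = l.

Lemma rV_linear (v : 'rV[R]_n) : p v = \sum_j v 0 j *: p (delta_mx 0 j).
Proof.
by rewrite {1}(row_sum_delta v) linear_sum; apply: eq_bigr => j _; rewrite linearZ.
Qed.

Lemma minimal_cover_kernel (w : M) j : min_number_gens L n -> m (iota w 0 j).
Proof.
move=> [_ nmin]; apply: contrapT => nm.
have E : \sum_i iota w 0 i *: p (delta_mx 0 i) = 0.
  by rewrite -rV_linear; apply/iota_range; exists w.
have [s [s_n _ sL]] := redundant_generator unitm E nm.
have /nmin : span [set` s] = [set: L].
  apply/seteqP; split=> // l _; have [v <-] := p_surj l.
  by rewrite rV_linear; apply: (sL (fun i => v 0 i)).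
by rewrite s_n; case: (n) j {nm} => [[]//|k _]; rewrite ltnn.
Qed.

Definition row_in (I : set R) (v : 'rV[R]_n) := forall j, I (v 0 j).

Lemma row_in_add_mul (I : set (reg R)) x (v : 'rV[R]_n) : row_in (add_mul I x) v ->
  exists u z, row_in I u /\ v = u + x *: z.
Proof.
move=> Iv.
have ex j : exists yw : (reg R * reg R)%type, I yw.1 /\ v 0 j = yw.1 + x *: yw.2.
  by have [a [c [Ia cE]]] := Iv j; exists (a, c).
have [f fE] := choice ex.
exists (\row_j ((f j).1 : R)), (\row_j ((f j).2 : R)); split.
  by move=> j; rewrite mxE; case: (fE j).
by apply/rowP => j; case: (fE j) => _ E; rewrite !mxE E.
Qed.

(** Tor_1(R/xs, L) = 0 for an L-regular sequence xs, i.e. the syzygy M of L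
meets (xs)R^n in (xs)M only. *)
Lemma syzygy_pure xs (I : set (reg R)) (SL : set L) (SM : set M) :
  is_submodule SL -> is_submodule I ->
  (forall v, SL (p v) -> exists2 u, row_in I u & p u = p v) ->
  (forall v, row_in I v -> SL (p v)) ->
  (forall w, row_in I (iota w) -> SM w) ->
  regs SL xs -> forall w, row_in (add_muls I xs) (iota w) -> add_muls SM xs w.
Proof.
elim: xs I SL SM => [|x xs IH] I SL SM sL sI lift push pure /=.
  by move=> _; apply: pure.
move=> [rx rxs]; apply: IH rxs.
- exact: add_mul_submod.
- exact: add_mul_submod.
- move=> v [l [l' [Sl vE]]].
  have [v0 v0E] := p_surj l; have [z zE] := p_surj l'.
  have [|u Iu uE] := lift v0; first by rewrite v0E.
  exists (u + x *: z); last by rewrite linearD linearZ uE v0E zE.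
  by move=> j; exists (u 0 j), (z 0 j); rewrite !mxE.
- move=> v /row_in_add_mul[u [z [Iu ->]]]; exists (p u), (p z).
  by split; [exact: push | rewrite linearD linearZ].
move=> w /row_in_add_mul[u [z [Iu wE]]].
have Sxz : SL (x *: p z).
  have : p (iota w) = 0 by apply/iota_range; exists w.
  rewrite wE linearD linearZ /= => /eqP; rewrite addrC addr_eq0 => /eqP ->.
  by apply: (submodN sL); apply: push.
have [z' Iz' z'E] := lift z (rx _ Sxz).
have /iota_range[w' w'E] : p (z - z') = 0 by rewrite linearB z'E subrr.
exists (w - x *: w'), w'; split; last by rewrite subrK.
apply: pure => j; rewrite linearB linearZ w'E wE /= scalerBr opprB.
rewrite -addrA [x *: z + _]addrC subrK !mxE; apply: (submodD sI) => //.
exact: (submodZ x sI (Iz' j)).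
Qed.

(** M lies in mR^n, so s moves it into (xs)R^n. *)
Lemma syzygy_socle xs s : min_number_gens L n -> regs [set (0 : L)] xs ->
  (forall a, m a -> add_muls [set (0 : reg R)] xs (a *: s)) ->
  forall w, add_muls [set (0 : M)] xs (s *: w).
Proof.
move=> Ln rxs ms w; apply: (syzygy_pure (I := [set 0]) (SL := [set 0])) rxs _ _.
- exact: submod_set0.
- exact: submod_set0.
- by move=> v v0; exists 0; [move=> j; rewrite mxE|rewrite linear0 v0].
- move=> v v0; suff -> : v = 0 by rewrite /= linear0.
  by apply/rowP=> j; rewrite v0 mxE.
- move=> u u0; apply: iota_inj; rewrite linear0.
  by apply/rowP=> j; rewrite u0 mxE.
by move=> j; rewrite linearZ mxE mulrC; apply/ms/minimal_cover_kernel.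
Qed.

Lemma syzygy_zero_free : is_zero_module M -> is_free_module L.
Proof.
move=> M0.
have p_inj v : p v = 0 -> v = 0 by move=> /iota_range[w <-]; rewrite (M0 w) linear0.
exists 'I_n, (free_map (fun i => p (delta_mx 0 i))).
pose row (z : {freeg 'I_n / R}) : 'rV[R]_n := \row_i coeff i z.
have [|rowl rowlE] := @exists_linear R {freeg 'I_n / R} _ row.
  by move=> a u v; apply/rowP=> i; rewrite !mxE coeffD coeffZ.
have FE z : free_map (fun i => p (delta_mx 0 i)) z = p (rowl z).
  apply: (freeg_linear_ext (g := p \o rowl)) => i.
  rewrite free_mapE /= rowlE; congr (p _); apply/rowP=> j.
  by rewrite !mxE coeffU mul1r eqxx eq_sym.
have inj z z' : free_map (fun i => p (delta_mx 0 i)) z =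
    free_map (fun i => p (delta_mx 0 i)) z' -> z = z'.
  rewrite !FE => /eqP; rewrite -subr_eq0 -!linearB => /eqP/p_inj.
  rewrite linearB !rowlE => /eqP; rewrite subr_eq0 => /eqP/rowP E.
  by apply/eqP/freeg_eqP => i; have := E i; rewrite !mxE.
have ex l : exists z, free_map (fun i => p (delta_mx 0 i)) z = l.
  have [v <-] := p_surj l; exists (\sum_j v 0 j *: << j >>).
  rewrite linear_sum rV_linear; apply: eq_bigr => j _.
  by rewrite linearZ; congr (_ *: _); exact: free_mapE.
have [g gE] := choice ex.
by exists g => z; [apply: inj|]; rewrite gE.
Qed.

End Syzygy.

(** * Resolutions by powers of a semidualizing module *)

Section SemidualizingResolutions.
Variables (R : comNzRingType) (m : set R).
Hypothesis noeth : noetherian R.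
Variables (C : lmodType R).
Hypothesis sdC : semidualizing C.

Let fgC : finitely_generated C. Proof. by case: sdC. Qed.

Lemma Hom_pow b (h : {linear C -> pow C b}) : exists r : vec R b, forall c, h c = tens r c.
Proof.
have ex j : exists a, forall c, h c j = a *: c.
  by have [a aE] := sdual_homothety sdC (proj_pow C j \o h); exists a => c; rewrite -aE.
have [r rE] := choice ex.
by exists [ffun j => r j] => c; apply/ffunP=> j; rewrite rE !ffunE.
Qed.

Lemma tens_eq0 b (r : vec R b) : (forall c : C, tens r c = 0) -> r = 0.
Proof.
move=> r0; apply/ffunP=> j; rewrite ffunE; apply: (sdual_faithful sdC) => c.
by have /ffunP/(_ j) := r0 c; rewrite !ffunE.
Qed.

Section Complex.
Variables (X : lmodType R) (F : minres m X) (n : nat).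
Hypothesis F_bounded : forall i, (n < i)%N -> mr_rank F i = 0%N.

(** Hom(C, C^b) = R^b: Hom(C, _) turns the complex of the C^b back into F. *)
Lemma tens_lift i (h : {linear C -> pow C (mr_rank F i.+1)}) :
  (forall c, mxact C (mr_mx F i) (h c) = 0) ->
  exists h' : {linear C -> pow C (mr_rank F i.+2)},
    forall c, h c = mxact C (mr_mx F i.+1) (h' c).
Proof.
have [r rE] := Hom_pow h; move=> h0.
have /mr_exact[u uE] : mxact (reg R) (mr_mx F i) r = 0.
  by apply: tens_eq0 => c; rewrite -mxact_tens -rE.
have [g gE] := tens_linear C u.
by exists g => c; rewrite gE mxact_tens -uE rE.
Qed.

Lemma mxactK i (v : pow C (mr_rank F i.+2)) :
  mxact C (mr_mx F i) (mxact C (mr_mx F i.+1) v) = 0.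
Proof.
have E (j : 'I_(mr_rank F i.+2)) (c : C) :
    mxact C (mr_mx F i) (mxact C (mr_mx F i.+1) (tens (unit_vec R j) c)) = 0.
  rewrite !mxact_tens minres_dd.
  by apply/ffunP=> k; rewrite !ffunE scale0r.
by rewrite (sum_tens v) !linear_sum big1.
Qed.

Lemma pow0_zero b : b = 0%N -> is_zero_module (pow C b).
Proof. by move=> b0 v; apply/ffunP=> -[j jb]; exfalso; move: jb; rewrite b0. Qed.

Lemma tens_exact i : exact_at (G := fun k => (pow C (mr_rank F k) : lmodType R))
  (fun k => mxact C (mr_mx F k)) i.
Proof.
have [P] := proj_resolution_exists C.
apply: (exact_of_hom (P := P) (n := n) mxactK noeth fgC (sdual_faithful sdC)).
- by move=> l nl; apply: pow0_zero; apply: F_bounded.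
- by move=> j l f; apply: Ext0_lift_pow; case: sdC => _ E _; apply: E.
- by move=> k h; apply: tens_lift.
Qed.

End Complex.
End SemidualizingResolutions.

Section Conclusion.
Variables (R : comNzRingType) (m : set R).
Hypothesis noeth : noetherian R.
Hypothesis mI : is_ideal m.
Hypothesis m1 : ~ m 1.
Hypothesis unitm : forall a, ~ m a -> exists b, b * a = 1.
Variables (C : lmodType R).
Hypothesis sdC : semidualizing C.

Let fgC : finitely_generated C. Proof. by case: sdC. Qed.

(** Hom(C, _) turns the complex of the C^b augmented by the evaluation
C^b_0 -> X into the resolution F -> Hom(C, X), which is exact. *)
Lemma augment_exact (X : lmodType R) (F : minres m {linear C -> X}) n :
  (forall i, (n < i)%N -> mr_rank F i = 0%N) ->
  exists eps : {linear pow C (mr_rank F 0) -> X},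
    (forall x, exists v, eps v = x) /\
    forall v, eps v = 0 <-> exists u, v = mxact C (mr_mx F 0) u.
Proof.
move=> Fb; have [P] := proj_resolution_exists C.
have [eps epsE] := copair_pow (fun j => mr_aug F (unit_vec R j)).
have eps_tens r c : eps (tens r c) = mr_aug F r c.
  rewrite epsE [in RHS]linear_vec.
  have -> : (\sum_j r j *: mr_aug F (unit_vec R j)) c =
      \sum_j (r j *: mr_aug F (unit_vec R j)) c.
    by elim/big_rec2: _ => // j u h _ <-.
  by apply: eq_bigr => j _; rewrite ffunE linearZ.
pose G k : lmodType R := if k is j.+1 then (pow C (mr_rank F j) : lmodType R) else X.
pose D k : {linear G k.+1 -> G k} :=
  match k return {linear G k.+1 -> G k} with
  | 0 => eps | j.+1 => mxact C (mr_mx F j) end.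
have epsK v : eps (mxact C (mr_mx F 0) v) = 0.
  rewrite -(linear0 eps).
  rewrite (sum_tens v) !linear_sum linear0 big1 // => j _; rewrite mxact_tens eps_tens.
  have -> : mr_aug F (mxact (reg R) (mr_mx F 0) (unit_vec R j)) = 0.
    by apply/mr_aug_exact; exists (unit_vec R j).
  by [].
have DK k v : D k (D k.+1 v) = 0.
  by case: k v => [|k] v; [exact: epsK | exact: (@mxactK _ _ _ _ F k v)].
have Gz l : (n.+1 < l)%N -> is_zero_module (G l).
  by case: l => // l nl; apply: pow0_zero; apply: Fb.
have Gac i l (f : {linear res_obj P i.+1 -> G l.+1}) :
    (forall y, f (res_diff P i.+1 y) = 0) ->
    exists g : {linear res_obj P i -> G l.+1}, forall y, f y = g (res_diff P i y).
  by apply: Ext0_lift_pow; case: sdC => _ E _; apply: E.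
have Hex k (h : {linear C -> G k.+1}) : (forall c, D k (h c) = 0) ->
    exists h' : {linear C -> G k.+2}, forall c, h c = D k.+1 (h' c).
  case: k h => [|k] h h0; last exact: (tens_lift sdC h0).
  have [r rE] := Hom_pow sdC h.
  have /mr_aug_exact[u uE] : mr_aug F r = 0.
    by apply: linear_eq => c; rewrite -eps_tens -rE; exact: h0.
  have [g gE] := tens_linear C u.
  by exists g => c; rewrite rE uE -mxact_tens -gE.
exists eps; split.
  apply: (surjective_of_hom DK noeth fgC (sdual_faithful sdC) Gz Gac Hex) => h.
  have [r rE] := mr_surj F h; have [g gE] := tens_linear C r.
  by exists g => c; rewrite gE [D 0 _]eps_tens rE.
move=> v; split=> [v0|[u ->]//].
have [u uE] := exact_of_hom DK noeth fgC (sdual_faithful sdC) Gz Gac Hex (k := 0) v0.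
by exists u; rewrite -uE.
Qed.

(** Every map M -> Y lifts to C^b0 because Ext^i(M, C) = 0 up to the length of
the resolution. As Y is generated by images of M and the resolution is minimal,
C is generated by images of M up to mC, hence by Nakayama; so whatever sends M
into (xs)M sends C into (xs)C. *)
Lemma generated_by_syzygy (X Y M : lmodType R) (F : minres m X) t
    (eps : {linear pow C (mr_rank F 0) -> Y}) xs s :
  (forall i, (t < i)%N -> mr_rank F i = 0%N) ->
  (forall y, exists v, eps v = y) ->
  (forall v, eps v = 0 <-> exists u, v = mxact C (mr_mx F 0) u) ->
  (forall i, (i < t)%N -> Ext_eq0 i.+1 M C) ->
  (forall y : Y, span [set z | exists (h : {linear M -> Y}) w, z = h w] y) ->
  (forall w : M, add_muls [set 0] xs (s *: w)) ->
  mr_rank F 0 <> 0%N -> forall c : C, add_muls [set 0] xs (s *: c).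
Proof.
move=> Fb eps_surj eps_ker MC gen sM rk0.
pose V : set C := [set c | add_muls [set 0] xs (s *: c)].
have sA := add_muls_submod xs (submod_set0 C).
have sV : is_submodule V.
  split; first by rewrite /V /= scaler0; apply: (submod0 sA).
  move=> a u v Vu Vv; rewrite /V /= scalerDr scalerA mulrC -scalerA.
  by apply: (submodD sA) => //; apply: (submodZ _ sA).
have [P] := proj_resolution_exists M.
have lift (h : {linear M -> Y}) : exists h' : {linear M -> pow C (mr_rank F 0)},
    forall w, eps (h' w) = h w.
  have [|f fE] := proj_lift (g := eps) (h := h \o res_aug P) (@res_proj _ _ P 0).
    by move=> y; apply: eps_surj.
  have [|||g [h' h'E]] := @lift_from_module R
      (fun k => (pow C (mr_rank F k) : lmodType R)) (fun k => mxact C (mr_mx F k))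
      (@mxactK R m C X F) M P t 0 _ (fun l _ => @tens_exact R m noeth C sdC X F t Fb l) _ f.
  - by move=> l tl; apply: pow0_zero; apply: Fb.
  - by move=> i l it _ f'; apply: Ext0_lift_pow; apply: MC.
  - move=> y; have /eps_ker[u ->] : eps (f (res_diff P 0 y)) = 0.
      by rewrite fE /= res_augK linear0.
    by exists u.
  exists h' => w; have [y <-] := res_aug_onto P w.
  have : eps (f y) = h (res_aug P y) by rewrite fE.
  rewrite h'E linearD => <-.
  have -> : eps (mxact C (mr_mx F 0) (g y)) = 0 by apply/eps_ker; exists (g y).
  by rewrite addr0.
have reach (y : Y) : exists2 v, eps v = y & forall j, V (v j).
  move: (gen y); move: y; refine (span_ind _ _).
    split; first by exists 0; [rewrite linear0|move=> j; rewrite ffunE; apply: (submod0 sV)].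
    move=> a _ _ [u <- Vu] [v <- Vv]; exists (a *: u + v); first by rewrite linearP.
    move=> j; rewrite !ffunE; apply: (submodD sV) => //; exact: (submodZ _ sV).
  move=> _ [h [w ->]]; have [h' h'E] := lift h.
  exists (h' w) => // j.
  have := add_muls_linear (f := proj_pow C j \o h') (T := [set 0]) _ (sM w).
  by rewrite linearZ; apply=> v ->; exact: linear0.
have j0 : 'I_(mr_rank F 0) by case: (mr_rank F 0) rk0 => // b _; exact: ord0.
suff /seteqP[_ VT] : V = setT by move=> c; apply: VT.
refine (nakayamaT mI m1 unitm sV fgC _) => c.
have [v vE Vv] := reach (eps (tens (unit_vec R j0) c)).
have /eps_ker[u uE] : eps (tens (unit_vec R j0) c - v) = 0.
  by rewrite linearB vE subrr.
exists (v j0), (mxact C (mr_mx F 0) u j0); split=> //.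
  by apply: mxact_ideal_smul; apply: mr_in.
by rewrite -uE !ffunE eqxx scale1r addrC subrK.
Qed.

(** Each c in C induces a map X -> Y, since the cokernel Y is the tensor product
of C and X; the images of these maps generate Y. *)
Lemma cokernel_generated (X Y M : lmodType R) (F : minres m X)
    (eps : {linear pow C (mr_rank F 0) -> Y}) :
  (forall y, exists v, eps v = y) ->
  (forall v, eps v = 0 <-> exists u, v = mxact C (mr_mx F 0) u) ->
  (forall x : X, span [set z | exists (h : {linear M -> X}) w, z = h w] x) ->
  forall y : Y, span [set z | exists (h : {linear M -> Y}) w, z = h w] y.
Proof.
move=> eps_surj eps_ker gen y; have [v <-] := eps_surj y.
set S := [set z | _]; have sS := span_is_submodule S.
rewrite (sum_tens v) linear_sum; apply: (submod_sum sS) => j _.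
move: (v j) (unit_vec R j) => c r.
have [|k kE] := @exists_linear R (vec R (mr_rank F 0)) Y (fun r => eps (tens r c)).
  move=> a u w; rewrite -linearP; congr (eps _); apply/ffunP=> i.
  by rewrite !ffunE scalerDl scalerA.
have [|th thE] := factor_surj (f := k) (@mr_surj _ _ _ F).
  move=> u /mr_aug_exact[w ->]; rewrite kE -mxact_tens.
  by apply/eps_ker; exists (tens w c).
rewrite -kE -thE; have := gen (mr_aug F r).
move: (mr_aug F r); refine (span_ind _ _); first exact: (preim_submod th sS).
by move=> _ [h [w ->]]; apply: span_sub; exists (th \o h), w.
Qed.

End Conclusion.

(** * The equivalence *)

Section ZeroModule.
Variable R : comNzRingType.

Lemma zero_finite_pd (X : lmodType R) : is_zero_module X -> finite_pd X.
Proof.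
move=> X0.
have projX : is_projective X.
  by move=> A B g h _; exists \0 => x; rewrite (X0 x) !linear0.
have surj0 (f : {linear X -> X}) : range f = setT.
  by apply: surj_range => x; exists 0; rewrite linear0 (X0 x).
have ker0 (f g : {linear X -> X}) : range f = [set x | g x = 0].
  by rewrite surj0; apply/seteqP; split=> // x _ /=; apply: X0.
pose P := @ProjResolution R X (fun=> X) (fun=> \0) \0 (fun=> projX)
  (surj0 _) (ker0 _ _) (fun=> ker0 _ _).
by exists P, 0%N => i _; exact: X0.
Qed.

Lemma tensor_zero_right (M N : lmodType R) : is_zero_module N -> is_zero_module (tensor M N).
Proof.
move=> N0 z; have := tensor_span z; apply: (span_min (submod_set0 _)) => _ [x [y ->]].
by have [h hE] := pure_tensor_linearr N x; rewrite -hE (N0 y) linear0.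
Qed.

End ZeroModule.

Theorem corollary3p18 (R : comNzRingType) (m : set R) (t : nat)
    (C M N L : lmodType R)
    (R_local : is_local m) (R_noeth : noetherian R)
    (R_depth : depth_eq m (R^o : lmodType R) t)
    (C_sdual : semidualizing C)
    (M_fg : finitely_generated M) (N_fg : finitely_generated N)
    (L_fg : finitely_generated L) (L_nonfree : ~ is_free_module L)
    (L_depth : depth_ge m L t)
    (M_syz : is_first_syzygy L M)
    (M_Ext : (1 <= t)%N -> forall i, (1 <= i <= t)%N -> Ext_eq0 i M C) :
  [<-> is_zero_module N;
       finite_pd (tensor M N);
       finite_pd {linear C -> tensor M N}].
Proof.
have [mI m1 unitm] := local_ringP R_local R_noeth.
have C_fg : finitely_generated C by case: C_sdual.
have [xs [mxs xs_t xsR xsL soc]] :=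
  common_maximal_regs R_noeth mI m1 R_depth L_depth L_fg.
have [s ns ms] := soc.
have M_nz : ~ is_zero_module M /\ forall w : M, add_muls [set 0] xs (s *: w).
  have [n [p [f [Ln p_surj [f' fK f'K]]]]] := M_syz.
  have [|iota iotaE] := @exists_linear R M 'rV[R]_n (fun w => val (f w)).
    by move=> a u v; rewrite !linearP.
  have iota_inj : injective iota.
    by move=> u v; rewrite !iotaE => /val_inj/(can_inj fK).
  have iota_range v : p v = 0 <-> exists w, iota w = v.
    split=> [pv|[w <-]]; last by rewrite iotaE; apply/eqP; exact: (valP (f w)).
    have k : v \in ker_mem p by rewrite unfold_in; apply/eqP.
    by exists (f' (exist _ v k)); rewrite iotaE f'K.
  split; first by move/(syzygy_zero_free iota_range (surj_ex p_surj)).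
  apply: (syzygy_socle unitm iota_inj iota_range (surj_ex p_surj) Ln xsL).
  by move=> a ma; apply: ms.
have [M_neq0 sM] := M_nz.
have X_fg : finitely_generated (tensor M N) by apply: tensor_fg.
have MC i : (i < t)%N -> Ext_eq0 i.+1 M C.
  by move=> it; apply: M_Ext => //; apply: leq_trans it.
have X_gen (x : tensor M N) :
    span [set z | exists (h : {linear M -> tensor M N}) w, z = h w] x.
  move: x (tensor_span x); refine (span_ind _ _); first exact: span_is_submodule.
  move=> _ [u [v ->]]; have [h hE] := pure_tensor_linear M v.
  by apply: span_sub; exists h, u.
have [P] := proj_resolution_exists C.
have rank0 (Y X : lmodType R) (F : minres m X)
    (eps : {linear pow C (mr_rank F 0) -> Y}) : finite_pd X ->
    (forall y, exists v, eps v = y) ->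
    (forall v, eps v = 0 <-> exists u, v = mxact C (mr_mx F 0) u) ->
    (forall y : Y, span [set z | exists (h : {linear M -> Y}) w, z = h w] y) ->
    mr_rank F 0 = 0%N.
  move=> pdX eps_surj eps_ker gen; apply: contrapT => rk0.
  have Fb i : (t < i)%N -> mr_rank F i = 0%N.
    by rewrite -xs_t; apply: (minres_depth_bound mI m1 F xsR soc pdX).
  case: ns; apply: (sdual_quot_faithful R_noeth C_sdual P xsR).
  exact: (generated_by_syzygy R_noeth mI m1 unitm C_sdual Fb eps_surj eps_ker MC gen sM rk0).
have N_zero : is_zero_module (tensor M N) -> is_zero_module N.
  by move=> /(tensor_eq0 mI m1 unitm M_fg N_fg)[].
have ii_i : finite_pd (tensor M N) -> is_zero_module N.
  move=> pdX; apply: N_zero; have [F] := minres_exists R_noeth unitm X_fg.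
  have [eps [_ eps_surj eps_ker]] := quot_lin (range (mxact C (mr_mx F 0))).
  have {}eps_ker v : eps v = 0 <-> exists u, v = mxact C (mr_mx F 0) u.
    rewrite eps_ker (span_id (range_submod _)).
    by split=> [[u _ <-]|[u ->]]; exists u.
  (* Y is the tensor product of C and X *)
  have F0 := rank0 _ _ F eps pdX eps_surj eps_ker
    (cokernel_generated eps_surj eps_ker X_gen).
  by move=> x; have [v <-] := mr_surj F x; rewrite (pow0_zero F0 v) linear0.
tfae.
- by move=> /(@tensor_zero_right _ M)/zero_finite_pd.
- move=> /ii_i/(@tensor_zero_right _ M) T0; apply: zero_finite_pd => h.
  by apply: linear_eq => c; rewrite (T0 (h c)).
move=> pdH; apply: N_zero.
have [F] := minres_exists R_noeth unitm (hom_fg R_noeth C_fg X_fg).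
have [n Fb] := minres_finite mI m1 F pdH.
have [eps [eps_surj eps_ker]] := augment_exact R_noeth C_sdual Fb.
(* Y = X, resolved through Hom(C, X) *)
have F0 := rank0 _ _ F eps pdH eps_surj eps_ker X_gen.
by move=> x; have [v <-] := eps_surj x; rewrite (pow0_zero F0 v) linear0.
Qed.
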